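(* Let $\mathfrak{g}$ be a $6$-dimensional strongly unimodular almost nilpotent real Lie algebra with nilradical $\mathfrak{n}$ satisfying $\dim\mathfrak{n}^1=1$, where $\mathfrak{n}^1=[\mathfrak{n},\mathfrak{n}]$. Then $\mathfrak{g}$ admits complex structures $J$ satisfying $J\mathfrak{n}^1\not\subset\mathfrak{n}$ if and only if it is isomorphic to one of the following: - $\mathfrak{h}_3\oplus\mathfrak{s}_{3.3}^0=(f^{23},0,0,f^{56},-f^{46},0)$, - $\mathfrak{s}_{4.7}\oplus\mathbb{R}^2=(f^{23},f^{36},-f^{26},0,0,0)$, - $\mathfrak{s}_{6.44}=(f^{23},f^{36},-f^{26},f^{26}+f^{56},f^{36}-f^{46},0)$, - $\mathfrak{s}_{6.52}^{0,b}=(f^{23},f^{36},-f^{26},bf^{56},-bf^{46},0)$, $b>0$, - $\mathfrak{s}_{6.159}=(f^{24}+f^{35},0,-f^{56},0,f^{36},0)$, - $\mathfrak{s}_{6.162}^{1}=(f^{24}+f^{35},f^{26},f^{36},-f^{46},-f^{56},0)$, - $\mathfrak{s}_{6.165}^a=(f^{24}+f^{35},af^{26}+f^{36},-f^{26}+af^{36},-af^{46}+f^{56},-f^{46}-af^{56},0)$, $a>0$, - $\mathfrak{s}_{6.166}^a=(f^{24}+f^{35},-f^{46},-af^{56},f^{26},af^{36},0)$, $0<|a|\le 1$, - $\mathfrak{s}_{6.167}=(f^{24}+f^{35},f^{36},-f^{26},f^{26}+f^{56},f^{36}-f^{46},0)$. An explicit example of such a complex structure is given by $Jf_1=f_6$,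 $Jf_2=f_3$, $Jf_4=f_5$ for all the Lie algebras in the list, with the exception of $\mathfrak{s}_{6.159}$ and $\mathfrak{s}_{6.166}^a$, for which one has $Jf_1=f_6$, $Jf_2=-f_4$, $Jf_3=f_5$.
   Context: The nilradical $\mathfrak{n}$ of a solvable Lie algebra $\mathfrak{g}$ is its maximal nilpotent ideal; $\mathfrak{g}$ is almost nilpotent if it is solvable and $\mathfrak{n}$ has codimension one. With $\mathfrak{n}^0=\mathfrak{n}$, $\mathfrak{n}^{l}=[\mathfrak{n},\mathfrak{n}^{l-1}]$, a solvable $\mathfrak{g}$ is strongly unimodular if $\operatorname{tr}(\mathrm{ad}_X|_{\mathfrak{n}^l/\mathfrak{n}^{l+1}})=0$ for all $X\in\mathfrak{g}$ and all $l\in\mathbb{N}$. Structure equations: $(\phi_1,\dots,\phi_6)$ denotes the Lie algebra with a basis $\{f_1,\dots,f_6\}$ whose dual basis satisfies $df^k=\phi_k$, where $f^{kl}=f^k\wedge f^l$ and $d\alpha(X,Y)=-\alpha([X,Y])$. A complex structure on $\mathfrak{g}$ is an endomorphism $J$ with $J^2=-\mathrm{Id}$ and $[JX,JY]-J[JX,Y]-J[X,JY]-[X,Y]=0$ for all $X,Y$. *)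

(* Defs.v *)
From HB Require Import structures.
From mathcomp Require Import all_boot all_order all_algebra.
From mathcomp Require Import reals.
From mathcomp Require Import ring.

Set Implicit Arguments.
Unset Strict Implicit.
Unset Printing Implicit Defensive.

Import Order.TTheory GRing.Theory Num.Theory.
Local Open Scope ring_scope.

HB.mixin Record Vector_isLieAlgebra (R : fieldType) V of Vector R V := {
  lie : V -> V -> V;
  lie_linearl : forall y a x1 x2,
    lie (a *: x1 + x2) y = a *: lie x1 y + lie x2 y;
  lie_linearr : forall x a y1 y2,
    lie x (a *: y1 + y2) = a *: lie x y1 + lie x y2;
  liexx : forall x, lie x x = 0;
  lie_jacobi : forall x y z,
    lie x (lie y z) + lie y (lie z x) + lie z (lie x y) = 0
}.

#[short(type="lieAlgType")]
HB.structure Definition LieAlgebra (R : fieldType) :=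
  { V of Vector_isLieAlgebra R V & Vector R V }.

Notation "[< x , y >]" := (lie x y) (at level 0, format "[<  x ,  y  >]").

Section LieTheory.
Variables (R : fieldType) (g : lieAlgType R).
Implicit Types (U V I n : {vspace g}) (f J : 'End(g)).

HB.instance Definition _ (x : g) :=
  GRing.isLinear.Build R g g *:%R (lie x) (lie_linearr x).

Definition ad (x : g) : 'End(g) := linfun (lie x).

Lemma adE x y : ad x y = [< x, y >].
Proof. by rewrite lfunE. Qed.

(* By bilinearity, the span of all brackets [u, v] with u in U and v in V. *)
Definition lieV U V : {vspace g} :=
  <<[seq [< u, v >] | u <- vbasis U, v <- vbasis V]>>%VS.

Definition ideal I := (lieV fullv I <= I)%VS.

(* U^0 = U and U^l = [U, U^(l-1)]. *)
Definition lcs U (l : nat) : {vspace g} := iter l (lieV U) U.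

Definition derived_series U (l : nat) : {vspace g} :=
  iter l (fun W => lieV W W) U.

Definition nilpotent U := exists l, lcs U l = 0%VS.

Definition solvable := exists l, derived_series fullv l = 0%VS.

Definition nilradical n :=
  [/\ ideal n, nilpotent n &
      forall I, ideal I -> nilpotent I -> (n <= I)%VS -> I = n].

Definition almost_nilpotent n :=
  [/\ solvable, nilradical n & (\dim n).+1 = \dim {:g}].

(* The trace of the endomorphism induced on the quotient W / U, for U <= W    *)
(* both stable under f. The quotient is represented by the complement W :\: U *)
(* of U in W, and addv_pi1 W U, the projection on that complement along U,    *)
(* plays the role of the canonical map W -> W / U.                            *)
Definition quot_trace f W U : R :=
  \sum_(i < \dim (W :\: U))
     coord (vbasis (W :\: U)) i (addv_pi1 W U (f (vbasis (W :\: U))`_i)).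

Definition strongly_unimodular n :=
  [/\ solvable, nilradical n &
      forall (x : g) (l : nat), quot_trace (ad x) (lcs n l) (lcs n l.+1) = 0].

Definition complex_structure J :=
  (forall x, J (J x) = - x) /\
  (forall x y, [< J x, J y >] - J [< J x, y >] - J [< x, J y >] - [< x, y >]
               = 0).

End LieTheory.

Arguments solvable {R} g.

Definition lie_isomorphic (R : fieldType) (g h : lieAlgType R) :=
  exists f : {linear g -> h},
    bijective f /\ forall x y, f [< x, y >] = [< f x, f y >].

Section StructureEquations.
Variable R : fieldType.

(* A 2-form on R^6 is encoded by its (skew-symmetric) Gram matrix. *)
Definition form_eval (w : 'M[R]_6) (x y : 'rV[R]_6) : R :=
  (x *m w *m y^T) 0 0.

(* Indices of basis vectors start at 1, as in f_1, ..., f_6. *)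
Definition idx (k : nat) : 'I_6 := inord k.-1.

(* f^{ij} = f^i /\ f^j *)
Definition fw (i j : nat) : 'M[R]_6 :=
  delta_mx (idx i) (idx j) - delta_mx (idx j) (idx i).

(* The equations d f^k = phi_k with d alpha (x, y) = - alpha [x, y] determine *)
(* the bracket.                                                               *)
Definition str_lie (phi : 6.-tuple 'M[R]_6) (x y : 'rV[R]_6) : 'rV[R]_6 :=
  \row_k - form_eval (tnth phi k) x y.

Record lieEqs := LieEqs {
  str_eqs :> 6.-tuple 'M[R]_6;
  str_liexx : forall x, str_lie str_eqs x x = 0;
  str_jacobi : forall x y z,
    str_lie str_eqs x (str_lie str_eqs y z)
    + str_lie str_eqs y (str_lie str_eqs z x)
    + str_lie str_eqs z (str_lie str_eqs x y) = 0
}.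

Lemma form_evalDl w a x1 x2 y :
  form_eval w (a *: x1 + x2) y = a * form_eval w x1 y + form_eval w x2 y.
Proof. by rewrite /form_eval !mulmxDl -!scalemxAl !mxE. Qed.

Lemma form_evalDr w a x y1 y2 :
  form_eval w x (a *: y1 + y2) = a * form_eval w x y1 + form_eval w x y2.
Proof.
by rewrite /form_eval linearD linearZ /= mulmxDr -scalemxAr !mxE.
Qed.

Lemma str_lie_linearl phi y a x1 x2 :
  str_lie phi (a *: x1 + x2) y = a *: str_lie phi x1 y + str_lie phi x2 y.
Proof. by apply/rowP => k; rewrite !mxE form_evalDl opprD mulrN. Qed.

Lemma str_lie_linearr phi x a y1 y2 :
  str_lie phi x (a *: y1 + y2) = a *: str_lie phi x y1 + str_lie phi x y2.
Proof. by apply/rowP => k; rewrite !mxE form_evalDr opprD mulrN. Qed.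

Definition lie_of (E : lieEqs) : Type := 'rV[R]_6.

HB.instance Definition _ E := Vector.copy (lie_of E) 'rV[R]_6.
HB.instance Definition _ E := Vector_isLieAlgebra.Build R (lie_of E)
  (str_lie_linearl E) (str_lie_linearr E) (@str_liexx E) (@str_jacobi E).

Definition fv (E : lieEqs) (k : nat) : lie_of E := delta_mx 0 (idx k).

(* The dual basis of fv satisfies the prescribed structure equations. *)
Lemma str_lieE (E : lieEqs) (k : 'I_6) (x y : lie_of E) :
  - ([< x, y >] : 'rV_6) 0 k = form_eval (tnth E k) x y.
Proof. by rewrite mxE opprK. Qed.

Lemma form_fw i j x y :
  form_eval (fw i j) x y
  = x 0 (idx i) * y 0 (idx j) - x 0 (idx j) * y 0 (idx i).
Proof.
have E a b : form_eval (delta_mx a b) x y = x 0 a * y 0 b.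
  rewrite /form_eval mxE (bigD1 b) //= big1 => [|k kb]; last first.
    rewrite mxE big1 ?mul0r // => l _.
    by rewrite mxE (negbTE kb) andbF mulr0.
  rewrite addr0 !mxE (bigD1 a) //= big1 => [|l la].
    by rewrite mxE !eqxx mulr1 addr0.
  by rewrite mxE (negbTE la) mulr0.
by rewrite -!E /form_eval /fw mulmxBr mulmxBl !mxE.
Qed.

Lemma form_0 x y : form_eval 0 x y = 0.
Proof. by rewrite /form_eval mulmx0 mul0mx mxE. Qed.

Lemma form_D v w x y :
  form_eval (v + w) x y = form_eval v x y + form_eval w x y.
Proof. by rewrite /form_eval mulmxDr mulmxDl mxE. Qed.

Lemma form_N w x y : form_eval (- w) x y = - form_eval w x y.
Proof. by rewrite /form_eval mulmxN mulNmx mxE. Qed.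

Lemma form_Z a w x y : form_eval (a *: w) x y = a * form_eval w x y.
Proof. by rewrite /form_eval -scalemxAr -scalemxAl mxE. Qed.

Definition formE := (form_D, form_N, form_Z, form_fw, form_0).

Lemma str_lie_idx (phi : 6.-tuple 'M[R]_6) x y k : (0 < k <= 6)%N ->
  (str_lie phi x y) 0 (idx k) = - form_eval (nth 0 phi k.-1) x y.
Proof.
by case: k => // k /= k6; rewrite mxE (tnth_nth 0) /idx inordK.
Qed.

Lemma rV_D (u v : 'rV[R]_6) k : (u + v) 0 k = u 0 k + v 0 k.
Proof. by rewrite mxE. Qed.

Lemma rV_0 k : (0 : 'rV[R]_6) 0 k = 0.
Proof. by rewrite mxE. Qed.

Lemma eq_idx (u v : 'rV[R]_6) :
  [/\ u 0 (idx 1) = v 0 (idx 1), u 0 (idx 2) = v 0 (idx 2)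
    & u 0 (idx 3) = v 0 (idx 3)] ->
  [/\ u 0 (idx 4) = v 0 (idx 4), u 0 (idx 5) = v 0 (idx 5)
    & u 0 (idx 6) = v 0 (idx 6)] -> u = v.
Proof.
case=> e1 e2 e3 [e4 e5 e6]; apply/rowP => k.
have : k = idx k.+1 by rewrite /idx inord_val.
by case: k => [[|[|[|[|[|[|k]]]]]] //= k6] ->.
Qed.

End StructureEquations.

Arguments fw {R} i%_N j%_N.
Arguments fv {R} E k%_N.

Ltac solve_liexx :=
  move=> x; apply: eq_idx; split;
  rewrite str_lie_idx //= !formE rV_0; ring.
Ltac solve_jacobi :=
  move=> x y z; apply: eq_idx; split;
  rewrite !rV_D rV_0 !str_lie_idx //= !formE ?str_lie_idx //= ?formE; ring.

Section List.
Variable R : fieldType.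
Implicit Types a b : R.

Definition h3_s3_3 : lieEqs R.
Proof.
refine (@LieEqs R [tuple fw 2 3; 0; 0; fw 5 6; - fw 4 6; 0] _ _).
- abstract solve_liexx.
- abstract solve_jacobi.
Defined.

Definition s4_7_R2 : lieEqs R.
Proof.
refine (@LieEqs R [tuple fw 2 3; fw 3 6; - fw 2 6; 0; 0; 0] _ _).
- abstract solve_liexx.
- abstract solve_jacobi.
Defined.

Definition s6_44 : lieEqs R.
Proof.
refine (@LieEqs R
  [tuple fw 2 3; fw 3 6; - fw 2 6; fw 2 6 + fw 5 6; fw 3 6 - fw 4 6; 0] _ _).
- abstract solve_liexx.
- abstract solve_jacobi.
Defined.

Definition s6_52 b : lieEqs R.
Proof.
refine (@LieEqs R
  [tuple fw 2 3; fw 3 6; - fw 2 6; b *: fw 5 6; - (b *: fw 4 6); 0] _ _).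
- abstract solve_liexx.
- abstract solve_jacobi.
Defined.

Definition s6_159 : lieEqs R.
Proof.
refine (@LieEqs R
  [tuple fw 2 4 + fw 3 5; 0; - fw 5 6; 0; fw 3 6; 0] _ _).
- abstract solve_liexx.
- abstract solve_jacobi.
Defined.

Definition s6_162 : lieEqs R.
Proof.
refine (@LieEqs R
  [tuple fw 2 4 + fw 3 5; fw 2 6; fw 3 6; - fw 4 6; - fw 5 6; 0] _ _).
- abstract solve_liexx.
- abstract solve_jacobi.
Defined.

Definition s6_165 a : lieEqs R.
Proof.
refine (@LieEqs R
  [tuple fw 2 4 + fw 3 5; a *: fw 2 6 + fw 3 6; - fw 2 6 + a *: fw 3 6;
         - (a *: fw 4 6) + fw 5 6; - fw 4 6 - a *: fw 5 6; 0] _ _).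
- abstract solve_liexx.
- abstract solve_jacobi.
Defined.

Definition s6_166 a : lieEqs R.
Proof.
refine (@LieEqs R
  [tuple fw 2 4 + fw 3 5; - fw 4 6; - (a *: fw 5 6); fw 2 6; a *: fw 3 6; 0]
  _ _).
- abstract solve_liexx.
- abstract solve_jacobi.
Defined.

Definition s6_167 : lieEqs R.
Proof.
refine (@LieEqs R
  [tuple fw 2 4 + fw 3 5; fw 3 6; - fw 2 6; fw 2 6 + fw 5 6; fw 3 6 - fw 4 6;
         0] _ _).
- abstract solve_liexx.
- abstract solve_jacobi.
Defined.

End List.

Section Families.
Variable R : numFieldType.

(* The algebras carrying J f1 = f6, J f2 = f3, J f4 = f5. *)
Variant list1 : lieEqs R -> Prop :=
| List_h3_s3_3 : list1 (h3_s3_3 R)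
| List_s4_7_R2 : list1 (s4_7_R2 R)
| List_s6_44 : list1 (s6_44 R)
| List_s6_52 b of 0 < b : list1 (s6_52 b)
| List_s6_162 : list1 (s6_162 R)
| List_s6_165 a of 0 < a : list1 (s6_165 a)
| List_s6_167 : list1 (s6_167 R).

(* The algebras carrying J f1 = f6, J f2 = - f4, J f3 = f5. *)
Variant list2 : lieEqs R -> Prop :=
| List_s6_159 : list2 (s6_159 R)
| List_s6_166 a of 0 < `|a| & `|a| <= 1 : list2 (s6_166 a).

End Families.

(* Main.v *)
Require Import Defs.
From HB Require Import structures.
From mathcomp Require Import all_boot all_order all_algebra.
From mathcomp Require Import reals.
From mathcomp Require Import ring lra.

(* Strong unimodularity makes n^1 = R z central. If e := J z lies outside n,  *)
(* then n = R z + V with V := n :&: J n, a complex plane on which ad e is     *)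
(* complex linear and skew for the Hermitian form given by the bracket        *)
(* V x V -> R z, the Nijenhuis condition making this bracket of type (1, 1).  *)
(* The algebra is determined by that pair up to rescaling both members, and   *)
(* the trace condition and non-nilpotency leave exactly the normal forms of   *)
(* the list: degenerate form (s_4.7, h_3 + s_3.3, s_6.44, s_6.52), elliptic   *)
(* derivation (s_6.159, s_6.166), parabolic (s_6.167) and hyperbolic          *)
(* (s_6.162, s_6.165).                                                        *)

Set Implicit Arguments.
Unset Strict Implicit.
Unset Printing Implicit Defensive.

Import Order.TTheory GRing.Theory Num.Theory.
Local Open Scope ring_scope.

(** For the forward direction, write n^1 = R z and e = J z. The trace condition on n^1/n^2 makes z
    central, and the Nijenhuis identity on pairs (z, x) then says that ad e commutes with J. Since e
    is outside n, V = n :&: J n is complementary to R z in n and stable under J and ad e. The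
    Nijenhuis and Jacobi identities turn the bracket V x V -> R z into a nonzero Hermitian form for
    which ad e is skew. A non-isotropic u and a v orthogonal to it reduce the algebra to numbers
    eps, a, b and c in {0, 1}: this is [hpres], obtained in [adapted_hermitian_basis].

    These data are classified in [hpres_in_list]. For c = 0 both form and derivation are diagonal.
    For c = 1, removing the scalar part i th leaves D0 with D0^2 = - (eps + d^2), and the sign of
    eps + d^2 tells whether the derivation is diagonalizable with imaginary spectrum, has a Jordan
    block, or has eigenvalues off the imaginary axis. Changes of basis and rescalings of z and e
    ([presented_change]) lead to the listed equations. Since g is not nilpotent,
    [presented_nilpotent] excludes D^2 = 0, so that the parameters to divide by are nonzero.

    For the converse, the two explicit J are checked in coordinates and carried over by
    [complex_structure_transport]. The nilradical is only given as some maximal nilpotent ideal;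
    [nilradical_top_coord] identifies it with x_6 = 0, so J f_1 = f_6 leaves it. *)

Section LieAlgebras.
Variables (R : fieldType) (g : lieAlgType R).
Implicit Types (x y z : g) (U V W I n : {vspace g}).

(** * Brackets of subspaces and nilpotency *)

Lemma lieC x y : [< x, y >] = - [< y, x >].
Proof.
have lD u v w : [< u + v, w >] = [< u, w >] + [< v, w >].
  by have := lie_linearl w 1 u v; rewrite !scale1r.
have := liexx (x + y); rewrite lD !linearD /= !liexx add0r addr0.
by move/eqP; rewrite addr_eq0 => /eqP.
Qed.

Lemma lieDl x y z : [< x + y, z >] = [< x, z >] + [< y, z >].
Proof. by rewrite lieC linearD opprD /= -!(lieC _ z). Qed.

Lemma lieZl a x z : [< a *: x, z >] = a *: [< x, z >].
Proof. by rewrite lieC linearZ /= -scalerN -lieC. Qed.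

Lemma lieDr x y z : [< z, x + y >] = [< z, x >] + [< z, y >].
Proof. exact: linearD. Qed.

Lemma lieZr a x z : [< z, a *: x >] = a *: [< z, x >].
Proof. exact: linearZ. Qed.

Lemma lie_suml (I : finType) (F : I -> g) z :
  [< \sum_i F i, z >] = \sum_i [< F i, z >].
Proof.
rewrite lieC linear_sum -sumrN; apply: eq_bigr => i _ /=.
by rewrite -lieC.
Qed.

Lemma mem_lieV U V x y : x \in U -> y \in V -> [< x, y >] \in lieV U V.
Proof.
move=> /coord_vbasis -> /coord_vbasis ->.
rewrite lie_suml memv_suml // => i _; rewrite lieZl memvZ //.
rewrite linear_sum memv_suml // => j _ /=; rewrite linearZ memvZ //.
apply: memv_span; apply/allpairsP; exists ((vbasis U)`_i, (vbasis V)`_j).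
by rewrite !mem_nth ?size_tuple.
Qed.

Lemma lieV_subP U V W :
  reflect (forall x y, x \in U -> y \in V -> [< x, y >] \in W)
          (lieV U V <= W)%VS.
Proof.
apply: (iffP idP) => [sub x y xU yV | UVW].
  by apply: (subvP sub); apply: mem_lieV.
apply/span_subvP => _ /allpairsP[[x y] /= [xU yV ->]].
by apply: UVW; apply: vbasis_mem.
Qed.

Lemma lieV_subr U V W : (V <= W)%VS -> (lieV U V <= lieV U W)%VS.
Proof.
by move=> /subvP VW; apply/lieV_subP => x y xU /VW; apply: mem_lieV.
Qed.

Lemma lieV0 U : lieV U 0 = 0%VS.
Proof.
apply/eqP; rewrite -subv0; apply/lieV_subP => x y _.
by rewrite memv0 => /eqP ->; rewrite linear0 mem0v.
Qed.

(** If [U, U^1] = U^1, the lower central series stays at U^1 forever, and nilpotency forces U^1 =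
    0. *)
Lemma nilpotent_lieV_proper U :
  nilpotent U -> (lieV U (lcs U 1) != lcs U 1) || (lcs U 1 == 0%VS).
Proof.
move=> [l Ul]; case: (altP (lieV U (lcs U 1) =P lcs U 1)) => // e.
apply/orP; right.
have <- : lcs U l.+1 = lcs U 1.
  by elim: l {Ul} => [|l IHl] //; rewrite -[RHS]e -IHl.
by rewrite [lcs U l.+1]/= -/(lcs U l) Ul lieV0.
Qed.

(** The first bracket with x already lies in I; the next ones descend the lower central series of I,
    whence the exponent l + 1. *)
Lemma nilpotent_ad x I :
  ideal I -> nilpotent I -> x \in I -> exists l, forall y, iter l (lie x) y = 0.
Proof.
move=> /lieV_subP idI [l Il] xI; exists l.+1 => y.
have Iy : [< x, y >] \in I by rewrite lieC memvN; apply: idI; rewrite ?memvf.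
apply/eqP; rewrite -memv0 -Il iterSr; elim: l {Il} => //= l IHl.
exact: mem_lieV.
Qed.

End LieAlgebras.

(** * Transport along isomorphisms, and traces on quotients *)

Section Isomorphisms.
Variables (R : fieldType) (g h : lieAlgType R) (f : 'Hom(g, h)) (f' : 'Hom(h, g)).
Hypotheses (fK : cancel f f') (f'K : cancel f' f).
Hypothesis fM : forall x y, f [< x, y >] = [< f x, f y >].

Lemma lie_iso_sym x y : f' [< x, y >] = [< f' x, f' y >].
Proof. by apply: (can_inj fK); rewrite fM !f'K. Qed.

Lemma lieV_img U V : lieV (f @: U) (f @: V) = (f @: lieV U V)%VS.
Proof.
apply/eqP; rewrite eqEsubv; apply/andP; split.
  apply/lieV_subP => _ _ /memv_imgP[x xU ->] /memv_imgP[y yV ->].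
  by rewrite -fM memv_img // mem_lieV.
apply/subvP => _ /memv_imgP[x xUV ->].
suff : x \in (f' @: lieV (f @: U) (f @: V))%VS.
  by move=> /memv_imgP[y ? ->]; rewrite f'K.
apply: (subvP _ _ xUV); apply/lieV_subP => {x xUV} x y xU yV.
by rewrite -[[<x,y>]]fK fM memv_img // mem_lieV // memv_img.
Qed.

Lemma lcs_img U l : lcs (f @: U) l = (f @: lcs U l)%VS.
Proof. by elim: l => //= l ->; rewrite lieV_img. Qed.

Lemma nilpotent_img U : nilpotent U -> nilpotent (f @: U).
Proof. by move=> [l Ul]; exists l; rewrite lcs_img Ul limg0. Qed.

Lemma ideal_img U : ideal U -> ideal (f @: U).
Proof.
move=> /lieV_subP idU; apply/lieV_subP => x _ _ /memv_imgP[y yU ->].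
by rewrite -[x]f'K -fM memv_img // idU // memvf.
Qed.

Lemma img_imgK U : (f' @: (f @: U))%VS = U.
Proof.
apply/vspaceP => x; apply/memv_imgP/idP => [[_ /memv_imgP[y yU ->] ->]|xU].
  by rewrite fK.
by exists (f x); rewrite ?fK ?memv_img.
Qed.

End Isomorphisms.

Lemma nilradical_img (R : fieldType) (g h : lieAlgType R)
    (f : 'Hom(g, h)) (f' : 'Hom(h, g)) (n : {vspace g}) :
  cancel f f' -> cancel f' f ->
  (forall x y, f [< x, y >] = [< f x, f y >]) ->
  nilradical n -> nilradical (f @: n).
Proof.
move=> fK f'K fM [idn niln maxn].
have f'M := lie_iso_sym fK f'K fM.
split; [exact: (ideal_img f'K) | exact: (nilpotent_img fK f'K) |].
move=> I idI nilI nI; rewrite -[LHS](img_imgK f'K); congr (f @: _)%VS.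
apply: maxn; [exact: (ideal_img fK) | exact: (nilpotent_img f'K fK) |].
by rewrite -(img_imgK fK n) limgS.
Qed.

Lemma quot_traceE (R : fieldType) (g : lieAlgType R) (f : 'End(g))
    (W U : {vspace g}) k (X : 'I_k -> g) (A : 'M[R]_k) :
  (U <= W)%VS -> \dim W = (k + \dim U)%N -> (f @: U <= U)%VS ->
  (forall i, X i \in W) ->
  (forall v : 'rV[R]_k, \sum_i v 0 i *: X i \in U -> v = 0) ->
  (forall i, f (X i) - \sum_j A i j *: X j \in U) ->
  quot_trace f W U = \tr A.
Proof.
move=> UW dimW fU XW Xfree fX.
have dimC : \dim (W :\: U) = k.
  have := dimv_cap_compl W U; rewrite (capv_idPr UW) dimW addnC.
  by move/addIn.
subst k; rewrite /quot_trace.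
set C := (W :\: U)%VS in X A dimW XW Xfree fX *.
set p := addv_pi1 W U.
have pC x : p x \in C by exact: memv_pi.
have pU x : x \in U -> p x = 0.
  move=> xU; have /addv_pi1_pi2 : x \in (W + U)%VS.
    by rewrite (subvP (addvSr W U)).
  by rewrite addv_pi2_id // => /(canRL (addrK _)); rewrite subrr.
have pW x : x \in W -> x - p x \in U.
  move=> xW; have : x \in (W + U)%VS by rewrite (addv_idPl UW).
  move=> /addv_pi1_pi2 {1}<-; rewrite addrC addKr; exact: memv_pi2.
(* [M] represents the induced map in the basis of the complement, and [B] expresses the classes of
   the [X i] in that basis. From [B *m M = A *m B] with [B] invertible, [M] and [A] are similar. *)
pose M := \matrix_(i, j < \dim C) coord (vbasis C) j (p (f (vbasis C)`_i)).
pose B := \matrix_(i, j < \dim C) coord (vbasis C) j (p (X i)).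
have BM : B *m M = A *m B.
  apply/matrixP => i j; rewrite !mxE.
  under eq_bigr do rewrite !mxE.
  under [RHS]eq_bigr do rewrite !mxE.
  transitivity (coord (vbasis C) j (p (f (p (X i))))).
    rewrite {2}(coord_vbasis (pC (X i))) !linear_sum.
    by apply: eq_bigr => l _ /=; rewrite !linearZ.
  transitivity (coord (vbasis C) j (p (\sum_l A i l *: X l))).
    congr (coord _ _ _); apply/eqP; rewrite -subr_eq0 -linearB; apply/eqP.
    apply: pU.
    rewrite -[f (p (X i))](subrK (f (X i))) -addrA memvD //.
    by rewrite -linearB (subvP fU) // memv_img // -memvN opprB pW.
  rewrite !linear_sum; apply: eq_bigr => l _ /=.
  by rewrite !linearZ.
have Bu : B \in unitmx.
  rewrite -row_free_unit -kermx_eq0; apply/eqP/row_matrixP => i.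
  rewrite row0; apply: Xfree.
  set v := row i (kermx B).
  have vB : v *m B = 0 by rewrite -row_mul mulmx_ker row0.
  have vW : \sum_i v 0 i *: X i \in W.
    by apply: memv_suml => l _; apply: memvZ.
  have pv : p (\sum_i v 0 i *: X i) = 0.
    rewrite (coord_vbasis (pC _)) big1 // => j _.
    suff -> : coord (vbasis C) j (p (\sum_i v 0 i *: X i)) = (v *m B) 0 j.
      by rewrite vB mxE scale0r.
    rewrite !linear_sum mxE; apply: eq_bigr => l _ /=.
    by rewrite !linearZ [B _ _]mxE.
  by have := pW _ vW; rewrite pv subr0.
transitivity (\tr M); first by apply: eq_bigr => i _; rewrite mxE.
by rewrite -[M](mulKmx Bu) BM mxtrace_mulC mulmxK.
Qed.

(** * Algebras given by a 2-form and a derivation on R^4 *)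

Section Presentations.
Variables (R : fieldType) (g : lieAlgType R).
Implicit Types (z e x y : g) (W D P : 'M[R]_4) (U : {vspace g}).

Definition lincomb k (X : 'I_k -> g) (v : 'rV[R]_k) : g := \sum_i v 0 i *: X i.

Lemma lincomb_is_linear k (X : 'I_k -> g) : linear (lincomb X).
Proof.
move=> a u v; rewrite /lincomb scaler_sumr -big_split; apply: eq_bigr => i _.
by rewrite !mxE scalerDl scalerA.
Qed.

HB.instance Definition _ k (X : 'I_k -> g) :=
  GRing.isLinear.Build R 'rV[R]_k g *:%R (lincomb X) (lincomb_is_linear X).

Lemma lincomb_delta k (X : 'I_k -> g) i : lincomb X (delta_mx 0 i) = X i.
Proof.
rewrite /lincomb (bigD1 i) //= big1 => [|j ji].
  by rewrite mxE !eqxx scale1r addr0.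
by rewrite mxE (negbTE ji) andbF scale0r.
Qed.

Lemma lincomb_mul k l (X : 'I_k -> g) (A : 'M_(l, k)) v :
  lincomb X (v *m A) = lincomb (fun i => lincomb X (row i A)) v.
Proof.
rewrite /lincomb; under eq_bigr do rewrite mxE scaler_suml.
rewrite exchange_big; apply: eq_bigr => i _; rewrite scaler_sumr.
by apply: eq_bigr => j _; rewrite mxE scalerA.
Qed.

Lemma lie_lincomb2 k (X : 'I_k -> g) z (W : 'M_k) :
    (forall i j, [< X i, X j >] = W i j *: z) ->
  forall u v, [< lincomb X u, lincomb X v >] = (u *m W *m v^T) 0 0 *: z.
Proof.
move=> XX u v; rewrite lie_suml mxE scaler_suml.
under [RHS]eq_bigr do rewrite mxE mulr_suml scaler_suml.
rewrite exchange_big; apply: eq_bigr => i _; rewrite lieZl linear_sum /=.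
rewrite scaler_sumr; apply: eq_bigr => j _.
by rewrite linearZ /= XX !scalerA !mxE mulrAC.
Qed.

Lemma lie_lincombr k (X : 'I_k -> g) e (D : 'M_k) :
    (forall i, [< e, X i >] = lincomb X (row i D)) ->
  forall u, [< e, lincomb X u >] = lincomb X (u *m D).
Proof.
move=> eX u; rewrite lincomb_mul linear_sum; apply: eq_bigr => i _ /=.
by rewrite linearZ /= eX.
Qed.

(* [g] is the semidirect product of the line spanned by [e], acting through   *)
(* [D], with the central extension of R^4 by [z] given by the 2-form [W].     *)
Definition presented W D := exists (z e : g) (X : 'I_4 -> g),
  [/\ forall a b v, a *: z + b *: e + lincomb X v = 0 ->
        [/\ a = 0, b = 0 & v = 0],
      forall x, [< z, x >] = 0,
      forall i j, [< X i, X j >] = W i j *: z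
    & forall i, [< e, X i >] = lincomb X (row i D)].

(** The freedom used by the classification: z is divided by t, e is multiplied by s, and the rows of
    P are the new basis vectors. *)
Lemma presented_change W D W' D' P (s t : R) : s != 0 -> t != 0 ->
    P \in unitmx -> W' = t *: (P *m W *m P^T) -> D' *m P = s *: (P *m D) ->
  presented W D -> presented W' D'.
Proof.
move=> s0 t0 Pu -> DP [z [e [X [free zC XX eX]]]].
exists (t^-1 *: z), (s *: e), (fun i => lincomb X (row i P)).
have lieX := lie_lincomb2 XX.
have lieeX := lie_lincombr eX.
split=> [a b v|x|i j|i].
- rewrite -lincomb_mul !scalerA => /free[/eqP a0 /eqP b0 vP].
  split; [move: a0 | move: b0 |].
  + by rewrite mulf_eq0 invr_eq0 (negbTE t0) orbF => /eqP.
  + by rewrite mulf_eq0 (negbTE s0) orbF => /eqP.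
  + by rewrite -[v](mulmxK Pu) vP mul0mx.
- by rewrite lieZl zC scaler0.
- rewrite lieX scalerA; congr (_ *: _).
  rewrite -row_mul !mxE mulrAC mulfV // mul1r.
  by apply: eq_bigr => k _; rewrite !mxE.
- by rewrite lieZl lieeX -lincomb_mul -!row_mul DP -linearZ -[in LHS]linearZ.
Qed.

Lemma presented_surj W D z e (X : 'I_4 -> g) : \dim {:g} = 6%N ->
  (forall a b v, a *: z + b *: e + lincomb X v = 0 ->
     [/\ a = 0, b = 0 & v = 0]) ->
  forall x, exists a b v, x = a *: z + b *: e + lincomb X v.
Proof.
move=> dim6 free.
pose F (u : 'rV[R]_(1 + 1 + 4)) :=
  lsubmx (lsubmx u) 0 0 *: z + rsubmx (lsubmx u) 0 0 *: e
  + lincomb X (rsubmx u).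
have Flin : linear F.
  move=> a u v; rewrite /F !linearP /= !mxE !scalerDr !scalerDl !scalerA.
  by rewrite (addrACA (_ *: z)) [LHS]addrACA.
pose F' := linfun (HB.pack F (GRing.isLinear.Build _ _ _ _ F Flin)
   : {linear 'rV[R]_(1 + 1 + 4) -> g}).
have FE u : F' u = F u by rewrite lfunE.
have F0 : lker F' == 0%VS.
  rewrite -subv0; apply/subvP => u; rewrite memv_ker FE memv0 => /eqP/free[a b v].
  rewrite -[u]hsubmxK v -[lsubmx u]hsubmxK.
  have -> : lsubmx (lsubmx u) = 0 by apply/rowP => i; rewrite ord1 a mxE.
  have -> : rsubmx (lsubmx u) = 0 by apply/rowP => i; rewrite ord1 b mxE.
  by rewrite !row_mx0.
have Fs : limg F' = fullv.
  apply/eqP; rewrite eqEdim subvf dim6 limg_dim_eq ?dimvf //.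
  by rewrite (eqP F0) capv0.
move=> x; have : x \in limg F' by rewrite Fs memvf.
by move=> /memv_imgP[u _ ->]; rewrite FE; do 3!eexists.
Qed.

(** Used contrapositively: in a non-nilpotent algebra D^2 is nonzero, which rules out vanishing
    parameters. *)
Lemma presented_nilpotent W D : \dim {:g} = 6%N -> presented W D ->
  D *m D = 0 -> nilpotent (fullv : {vspace g}).
Proof.
move=> dim6 [z [e [X [free zC XX eX]]]] DD.
have surj := presented_surj W D dim6 free.
(* [U k] is spanned by z and the image of D^k. Any bracket sends it into [U k.+1], and D^2 = 0 makes
   [U 2] the central line of z. *)
pose U k := (<[z]> + \sum_i <[iter k (lie e) (X i)]>)%VS.
have zU k : z \in U k by rewrite memvE addvSl.
have XU k i : iter k (lie e) (X i) \in U k.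
  rewrite memvE (subv_trans _ (addvSr _ _)) //.
  by rewrite (sumv_sup i).
have lieX u v : [< lincomb X u, lincomb X v >] \in <[z]>%VS.
  by rewrite (lie_lincomb2 XX) memvZ // memv_line.
have lieeX := lie_lincombr eX.
have iterX k i : exists v, iter k (lie e) (X i) = lincomb X v.
  elim: k => [|k [v /= ->]]; first by exists (delta_mx 0 i); rewrite lincomb_delta.
  by rewrite lieeX; eexists.
have step k : (lieV fullv (U k) <= U k.+1)%VS.
  apply/lieV_subP => x _ _ /memv_addP[_ /vlineP[t ->] [y ysum ->]].
  rewrite linearD /= linearZ /= lieC zC oppr0 scaler0 add0r.
  have : y \in (\sum_i <[iter k (lie e) (X i)]>)%VS by [].
  move=> /memv_sumP[c cP ->]; rewrite linear_sum memv_suml // => i _ /=.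
  have /vlineP[b ->] := cP i isT; rewrite linearZ memvZ //=.
  have [a [b' [v ->]]] := surj x; rewrite !lieDl !lieZl zC scaler0 add0r.
  rewrite memvD //; first by rewrite memvZ // (XU k.+1).
  have [w ->] := iterX k i.
  by apply: (subvP (addvSl _ _)).
have top : (lieV fullv fullv <= U 0%N)%VS.
  apply/lieV_subP => x y _ _.
  have [a [b [v ->]]] := surj x; have [a' [b' [v' ->]]] := surj y.
  have lcU w : lincomb X w \in U 0%N.
    by apply: memv_suml => i _; apply/memvZ/(XU 0%N).
  rewrite !lieDl !lieZl zC scaler0 add0r !linearD /= !linearZ /= liexx lieeX.
  rewrite lieC zC oppr0 !scaler0 !add0r.
  rewrite [[< _, z >]]lieC zC oppr0 !scaler0 !add0r.
  rewrite memvD ?memvZ //.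
  rewrite memvD ?memvZ //; first by rewrite lieC memvN lieeX.
  by apply: (subvP (addvSl _ _)).
have iterU k : (lcs fullv k.+1 <= U k)%VS.
  by elim: k => // k IHk; apply: subv_trans (step k); apply: lieV_subr.
exists 4%N; apply/eqP; rewrite -subv0 [lcs _ _]/=.
apply: subv_trans (lieV_subr _ (iterU 2%N)) _.
apply/lieV_subP => x y _; rewrite /U big1 ?addv0.
  by move=> /vlineP[t ->]; rewrite linearZ /= lieC zC oppr0 scaler0 mem0v.
move=> i _; rewrite /= eX lieeX -row_mul DD row0 linear0.
by rewrite -span_seq1 span_cons span_nil addv0.
Qed.

End Presentations.

(** * Explicit 4 x 4 matrices, reduced to sixteen scalar identities *)

Definition mx4 (R : pzSemiRingType) (s : seq (seq R)) : 'M[R]_4 :=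
  \matrix_(i, j) nth 0 (nth [::] s i) j.

Ltac mx4E :=
  apply/matrixP; do 2 (case=> [[|[|[|[|//]]]] ?] //);
  rewrite !(mxE, big_ord_recl, big_ord0) /=.

Section Mx4.
Variable R : comPzRingType.
Variables a11 a12 a13 a14 a21 a22 a23 a24 a31 a32 a33 a34 a41 a42 a43 a44 : R.
Variables b11 b12 b13 b14 b21 b22 b23 b24 b31 b32 b33 b34 b41 b42 b43 b44 : R.
Variable c : R.
Let A := [:: [:: a11; a12; a13; a14];
      [:: a21; a22; a23; a24];
      [:: a31; a32; a33; a34];
      [:: a41; a42; a43; a44]].
Let B := [:: [:: b11; b12; b13; b14];
      [:: b21; b22; b23; b24];
      [:: b31; b32; b33; b34];
      [:: b41; b42; b43; b44]].

Lemma mx4_mul : mx4 A *m mx4 B = mx4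
    [:: [:: a11 * b11 + a12 * b21 + a13 * b31 + a14 * b41;
          a11 * b12 + a12 * b22 + a13 * b32 + a14 * b42;
          a11 * b13 + a12 * b23 + a13 * b33 + a14 * b43;
          a11 * b14 + a12 * b24 + a13 * b34 + a14 * b44];
      [:: a21 * b11 + a22 * b21 + a23 * b31 + a24 * b41;
          a21 * b12 + a22 * b22 + a23 * b32 + a24 * b42;
          a21 * b13 + a22 * b23 + a23 * b33 + a24 * b43;
          a21 * b14 + a22 * b24 + a23 * b34 + a24 * b44];
      [:: a31 * b11 + a32 * b21 + a33 * b31 + a34 * b41;
          a31 * b12 + a32 * b22 + a33 * b32 + a34 * b42;
          a31 * b13 + a32 * b23 + a33 * b33 + a34 * b43;
          a31 * b14 + a32 * b24 + a33 * b34 + a34 * b44];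
      [:: a41 * b11 + a42 * b21 + a43 * b31 + a44 * b41;
          a41 * b12 + a42 * b22 + a43 * b32 + a44 * b42;
          a41 * b13 + a42 * b23 + a43 * b33 + a44 * b43;
          a41 * b14 + a42 * b24 + a43 * b34 + a44 * b44]].
Proof. by mx4E; rewrite addr0 !addrA. Qed.

Lemma mx4_tr : (mx4 A)^T = mx4
    [:: [:: a11; a21; a31; a41];
      [:: a12; a22; a32; a42];
      [:: a13; a23; a33; a43];
      [:: a14; a24; a34; a44]].
Proof. by mx4E. Qed.

Lemma mx4_scale : c *: mx4 A = mx4
    [:: [:: c * a11; c * a12; c * a13; c * a14];
      [:: c * a21; c * a22; c * a23; c * a24];
      [:: c * a31; c * a32; c * a33; c * a34];
      [:: c * a41; c * a42; c * a43; c * a44]].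
Proof. by mx4E. Qed.

Lemma mx4_opp : - mx4 A = mx4
    [:: [:: - a11; - a12; - a13; - a14];
      [:: - a21; - a22; - a23; - a24];
      [:: - a31; - a32; - a33; - a34];
      [:: - a41; - a42; - a43; - a44]].
Proof. by mx4E. Qed.

Lemma mx4_1 : 1%:M = mx4
    [:: [:: 1; 0; 0; 0];
      [:: 0; 1; 0; 0];
      [:: 0; 0; 1; 0];
      [:: 0; 0; 0; 1]] :> 'M[R]_4.
Proof. by mx4E. Qed.

Lemma mx4_0 : 0 = mx4
    [:: [:: 0; 0; 0; 0];
      [:: 0; 0; 0; 0];
      [:: 0; 0; 0; 0];
      [:: 0; 0; 0; 0]] :> 'M[R]_4.
Proof. by mx4E. Qed.

Lemma mx4_congr :
  a11 = b11 -> a12 = b12 -> a13 = b13 -> a14 = b14 ->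
  a21 = b21 -> a22 = b22 -> a23 = b23 -> a24 = b24 ->
  a31 = b31 -> a32 = b32 -> a33 = b33 -> a34 = b34 ->
  a41 = b41 -> a42 = b42 -> a43 = b43 -> a44 = b44 -> mx4 A = mx4 B.
Proof. by rewrite /A /B; do 16 move=> ->. Qed.

End Mx4.

Ltac mx4_simp :=
  rewrite ?(mx4_1, mx4_0) ?mx4_tr ?mx4_mul ?mx4_opp ?mx4_mul ?mx4_scale;
  apply: mx4_congr.

(** * The listed algebras as presentations *)

Section Models.
Variables (R : fieldType) (g : lieAlgType R).
Hypothesis dim6 : \dim {:g} = 6%N.

Definition vpart (x : 'rV[R]_6) : 'rV[R]_4 := \row_(i < 4) x 0 (idx i.+2).

(** f_1 corresponds to z, f_6 to e and f_2, ..., f_5 to the four [X i]. The matrices below carry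
    signs opposite to the structure equations because d alpha (x, y) = - alpha [x, y]. *)
Lemma presented_iso (W D : 'M[R]_4) (E : lieEqs R) :
    (forall x y, str_lie E x y 0 (idx 1) = (vpart x *m W *m (vpart y)^T) 0 0) ->
    (forall x y, vpart (str_lie E x y) =
       x 0 (idx 6) *: (vpart y *m D) - y 0 (idx 6) *: (vpart x *m D)) ->
    (forall x y, str_lie E x y 0 (idx 6) = 0) ->
  presented g W D -> lie_isomorphic g (lie_of E).
Proof.
move=> E1 EV E6 [z [e [X [free zC XX eX]]]].
pose F (u : lie_of E) :=
  (u : 'rV_6) 0 (idx 1) *: z + (u : 'rV_6) 0 (idx 6) *: e + lincomb X (vpart u).
have vpart_lin a u v : vpart (a *: u + v) = a *: vpart u + vpart v.
  by apply/rowP => i; rewrite !mxE.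
have Flin : linear F.
  move=> a u v; rewrite /F vpart_lin !mxE linearP /= !scalerDr !scalerDl !scalerA.
  by rewrite (addrACA (_ *: z)) [LHS]addrACA.
pose F' := linfun (HB.pack F (GRing.isLinear.Build _ _ _ _ F Flin)
   : {linear lie_of E -> g}).
have FE u : F' u = F u by rewrite lfunE.
have F0 : lker F' == 0%VS.
  rewrite -subv0; apply/subvP => u; rewrite memv_ker FE memv0 => /eqP/free[a b v].
  apply/eqP/eq_idx; split; rewrite mxE //.
  - by move/rowP: v => /(_ 0); rewrite !mxE.
  - by move/rowP: v => /(_ 1); rewrite !mxE.
  - by move/rowP: v => /(_ 2%:R); rewrite !mxE.
  - by move/rowP: v => /(_ 3%:R); rewrite !mxE.
have FK := lker0_lfunK F0.
have Fs : limg F' = fullv.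
  apply/eqP; rewrite eqEdim subvf dim6 limg_dim_eq ?dimvf //.
  by rewrite (eqP F0) capv0.
have FVK : cancel F'^-1%VF F' by move=> x; rewrite limg_lfunVK // Fs memvf.
have lieX := lie_lincomb2 XX.
have lieeX := lie_lincombr eX.
have zC' x : [< x, z >] = 0 by rewrite lieC zC oppr0.
have FM x y : F' [< x, y >] = [< F' x, F' y >].
  rewrite !FE /F (E1 x y) (EV x y) (E6 x y) scale0r addr0.
  rewrite !lieDl !lieZl zC scaler0 add0r !linearD /= !linearZ /= !zC'.
  rewrite !scaler0 liexx !scaler0 !add0r lieeX lieX [[< _, e >]]lieC lieeX.
  by rewrite linearN addrC -addrA.
exists F'^-1%VF; split.
  by exists F'.
by move=> x y; apply: (lker0P F0); rewrite FM !FVK.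
Qed.

Definition pairing : 'M[R]_4 :=
  mx4 [:: [:: 0; 0; -1; 0]; [:: 0; 0; 0; -1]; [:: 1; 0; 0; 0]; [:: 0; 1; 0; 0]].

Definition rank2_form : 'M[R]_4 :=
  mx4 [:: [:: 0; -1; 0; 0]; [:: 1; 0; 0; 0]; [:: 0; 0; 0; 0]; [:: 0; 0; 0; 0]].

Ltac model :=
  apply: presented_iso => x y;
  [ rewrite str_lie_idx //= !formE !(mxE, big_ord_recl, big_ord0) /=; ring
  | apply/rowP; case=> [[|[|[|[|//]]]] ?]; rewrite mxE str_lie_idx //= !formE;
    rewrite !(mxE, big_ord_recl, big_ord0) /=; ring
  | by rewrite str_lie_idx //= !formE; ring ].

Lemma presented_h3_s3_3 :
  presented g rank2_form (mx4 [:: [:: 0; 0; 0; 0]; [:: 0; 0; 0; 0];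
                                [:: 0; 0; 0; -1]; [:: 0; 0; 1; 0]]) ->
  lie_isomorphic g (lie_of (h3_s3_3 R)).
Proof. model. Qed.

Lemma presented_s4_7_R2 :
  presented g rank2_form (mx4 [:: [:: 0; -1; 0; 0]; [:: 1; 0; 0; 0];
                                [:: 0; 0; 0; 0]; [:: 0; 0; 0; 0]]) ->
  lie_isomorphic g (lie_of (s4_7_R2 R)).
Proof. model. Qed.

Lemma presented_s6_44 :
  presented g rank2_form (mx4 [:: [:: 0; -1; 1; 0]; [:: 1; 0; 0; 1];
                                [:: 0; 0; 0; -1]; [:: 0; 0; 1; 0]]) ->
  lie_isomorphic g (lie_of (s6_44 R)).
Proof. model. Qed.

Lemma presented_s6_52 b :
  presented g rank2_form (mx4 [:: [:: 0; -1; 0; 0]; [:: 1; 0; 0; 0];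
                                [:: 0; 0; 0; -b]; [:: 0; 0; b; 0]]) ->
  lie_isomorphic g (lie_of (s6_52 b)).
Proof. model. Qed.

Lemma presented_s6_159 :
  presented g pairing (mx4 [:: [:: 0; 0; 0; 0]; [:: 0; 0; 0; 1];
                                [:: 0; 0; 0; 0]; [:: 0; -1; 0; 0]]) ->
  lie_isomorphic g (lie_of (s6_159 R)).
Proof. model. Qed.

Lemma presented_s6_162 :
  presented g pairing (mx4 [:: [:: 1; 0; 0; 0]; [:: 0; 1; 0; 0];
                                [:: 0; 0; -1; 0]; [:: 0; 0; 0; -1]]) ->
  lie_isomorphic g (lie_of (s6_162 R)).
Proof. model. Qed.

Lemma presented_s6_165 a :
  presented g pairing (mx4 [:: [:: a; -1; 0; 0]; [:: 1; a; 0; 0];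
                                [:: 0; 0; -a; -1]; [:: 0; 0; 1; -a]]) ->
  lie_isomorphic g (lie_of (s6_165 a)).
Proof. model. Qed.

Lemma presented_s6_166 a :
  presented g pairing (mx4 [:: [:: 0; 0; 1; 0]; [:: 0; 0; 0; a];
                                [:: -1; 0; 0; 0]; [:: 0; -a; 0; 0]]) ->
  lie_isomorphic g (lie_of (s6_166 a)).
Proof. model. Qed.

Lemma presented_s6_167 :
  presented g pairing (mx4 [:: [:: 0; -1; 1; 0]; [:: 1; 0; 0; 1];
                                [:: 0; 0; 0; -1]; [:: 0; 0; 1; 0]]) ->
  lie_isomorphic g (lie_of (s6_167 R)).
Proof. model. Qed.

End Models.

(** * Normal forms of the Hermitian data *)

Section Classification.
Variables (R : rcfType) (g : lieAlgType R).
Hypothesis dim6 : \dim {:g} = 6%N.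
Hypothesis nonnil : ~ nilpotent (fullv : {vspace g}).

Definition in_list := exists E : lieEqs R,
  (list1 E \/ list2 E) /\ lie_isomorphic g (lie_of E).

(* The basis is [u, J u, v, J v]: the Hermitian form is diag(1, eps) and the  *)
(* derivation is the complex matrix with rows (i a, c) and (- eps c, i b).    *)
Definition hform (eps : R) : 'M[R]_4 :=
  mx4 [:: [:: 0; 1; 0; 0]; [:: -1; 0; 0; 0];
          [:: 0; 0; 0; eps]; [:: 0; 0; -eps; 0]].

Definition hder (eps a b c : R) : 'M[R]_4 :=
  mx4 [:: [:: 0; a; c; 0]; [:: -a; 0; 0; c];
          [:: - (eps * c); 0; 0; b]; [:: 0; - (eps * c); -b; 0]].

Definition hpres eps a b c := presented g (hform eps) (hder eps a b c).

Lemma hder_sq_neq0 eps a b c :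
  hpres eps a b c -> hder eps a b c *m hder eps a b c != 0.
Proof.
by move=> p; apply/negP => /eqP DD; apply: nonnil; apply: presented_nilpotent p DD.
Qed.

Lemma change_by_inverse W D W' D' (P Q : 'M[R]_4) (s t : R) :
    s != 0 -> t != 0 -> P *m Q = 1%:M ->
    W' = t *: (P *m W *m P^T) -> D' *m P = s *: (P *m D) ->
  presented g W D -> presented g W' D'.
Proof.
move=> s0 t0 PQ WP DP; apply: (presented_change s0 t0 _ WP DP).
by case: (mulmx1_unit PQ).
Qed.

(** When W' is invertible, W' = t P W P^T already forces P to be invertible. [change_by_inverse]
    serves the targets whose form may be degenerate. *)
Lemma change_by_form W D W' D' (P V : 'M[R]_4) (s t : R) :
    s != 0 -> t != 0 -> W' *m V = 1%:M ->
    W' = t *: (P *m W *m P^T) -> D' *m P = s *: (P *m D) ->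
  presented g W D -> presented g W' D'.
Proof.
move=> s0 t0 WV WP DP; apply: (presented_change s0 t0 _ WP DP).
by move: WV; rewrite WP -scalemxAl scalemxAr -!mulmxA => /mulmx1_unit[].
Qed.

Lemma pairing_sq : pairing R *m (- pairing R) = 1%:M.
Proof. by rewrite /pairing; mx4_simp; ring. Qed.

(** Exchanging v and J v reverses the complex structure on the second plane only, which is harmless
    since c = 0 decouples the planes. The form becomes definite at the cost of the sign of b. *)
Lemma hpres_flip a b : hpres (-1) a b 0 -> hpres 1 a (-b) 0.
Proof.
apply: (@change_by_form _ _ _ _
  (mx4 [:: [:: 1; 0; 0; 0]; [:: 0; 1; 0; 0]; [:: 0; 0; 0; 1]; [:: 0; 0; 1; 0]])
  (- hform 1) 1 1); rewrite ?oner_neq0 //;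
rewrite /hform /hder; mx4_simp; by ring.
Qed.

Lemma hpres_swap a b : hpres 1 a b 0 -> hpres 1 b a 0.
Proof.
apply: (@change_by_form _ _ _ _
  (mx4 [:: [:: 0; 0; 1; 0]; [:: 0; 0; 0; 1]; [:: 1; 0; 0; 0]; [:: 0; 1; 0; 0]])
  (- hform 1) 1 1); rewrite ?oner_neq0 //;
rewrite /hform /hder; mx4_simp; by ring.
Qed.

Lemma hpres_rescale k eps a b : k != 0 ->
  hpres eps a b 0 -> hpres (eps * k ^+ 2) a b 0.
Proof.
move=> k0; apply: (@change_by_inverse _ _ _ _
  (mx4 [:: [:: 1; 0; 0; 0]; [:: 0; 1; 0; 0]; [:: 0; 0; k; 0]; [:: 0; 0; 0; k]])
  (mx4 [:: [:: 1; 0; 0; 0]; [:: 0; 1; 0; 0];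
           [:: 0; 0; k^-1; 0]; [:: 0; 0; 0; k^-1]]) 1 1); rewrite ?oner_neq0 //;
rewrite /hform /hder; mx4_simp; by field.
Qed.

(** Swapping the planes gives |b| <= |a|, so b / a is in the parameter range of s_6.166 unless b =
    0, which is s_6.159. *)
Lemma hpres_definite_in_list a b : hpres 1 a b 0 -> in_list.
Proof.
wlog ba : a b / `|b| <= `|a|.
  move=> H p; case: (lerP `|b| `|a|) => [|/ltW] ab; first exact: (H a b).
  exact: (H b a) (hpres_swap p).
have [a0 | a0] := eqVneq a 0; last have [-> | b0] := eqVneq b 0.
- move=> p; case/eqP: (hder_sq_neq0 p).
  move: ba; rewrite a0 normr0 normr_le0 => /eqP ->.
  by rewrite /hder; mx4_simp; ring.
- move=> p; exists (s6_159 R); split; first by right; apply: List_s6_159.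
  apply: presented_s6_159 => //; move: p.
  apply: (@change_by_form _ _ _ _
    (mx4 [:: [:: 0; 0; 1; 0]; [:: 1; 0; 0; 0]; [:: 0; 0; 0; 1]; [:: 0; 1; 0; 0]])
    (- pairing R) a^-1 (-1)); rewrite ?oppr_eq0 ?oner_neq0 ?invr_neq0 //;
  rewrite /hform /hder /pairing; mx4_simp; by field.
- move=> p; exists (s6_166 (b / a)); split.
    right; apply: List_s6_166; rewrite normf_div ?divr_gt0 ?normr_gt0 //.
    by rewrite ler_pdivrMr ?normr_gt0 // mul1r.
  apply: presented_s6_166 => //; move: p.
  apply: (@change_by_form _ _ _ _
    (mx4 [:: [:: 1; 0; 0; 0]; [:: 0; 0; 1; 0]; [:: 0; 1; 0; 0]; [:: 0; 0; 0; 1]])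
    (- pairing R) a^-1 (-1)); rewrite ?oppr_eq0 ?oner_neq0 ?invr_neq0 //;
  rewrite /hform /hder /pairing; mx4_simp; by field.
Qed.

Lemma hpres_nondegenerate_in_list eps a b :
  eps != 0 -> hpres eps a b 0 -> in_list.
Proof.
move=> eps0 p.
have r0 : Num.sqrt `|eps| != 0 by rewrite sqrtr_eq0 -ltNge normr_gt0.
have := hpres_rescale (invr_neq0 r0) p.
rewrite exprVn sqr_sqrtr // => {}p.
have [neg | pos] := ltP eps 0.
  apply: (@hpres_definite_in_list a (- b)); apply: hpres_flip.
  by move: p; rewrite ltr0_norm // invrN mulrN divff.
apply: (@hpres_definite_in_list a b).
by move: p; rewrite ger0_norm // divff.
Qed.

Lemma hpres_degenerate_in_list a b : hpres 0 a b 0 -> in_list.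
Proof.
move=> p.
(* The second plane is the radical of the form, so multiplying J v by the sign [P] only affects the
   sign of b; this makes the parameter of s_6.52 positive. *)
have change P s D' : s != 0 -> P ^+ 2 = 1 ->
    D' *m mx4 [:: [:: 1; 0; 0; 0]; [:: 0; 1; 0; 0];
                  [:: 0; 0; 1; 0]; [:: 0; 0; 0; P]] =
    s *: (mx4 [:: [:: 1; 0; 0; 0]; [:: 0; 1; 0; 0];
                  [:: 0; 0; 1; 0]; [:: 0; 0; 0; P]] *m hder 0 a b 0) ->
    presented g (rank2_form R) D'.
  move=> s0 P1 DP; move: p.
  set M := mx4 _ in DP; apply: (@change_by_inverse _ _ _ _ M M s (-1)) => //.
  - by rewrite oppr_eq0 oner_neq0.
  - by rewrite /M; mx4_simp; rewrite -?expr2 ?P1; ring.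
  - by rewrite /M /rank2_form /hform; mx4_simp; ring.
have [a0 | a0] := eqVneq a 0; have [b0 | b0] := eqVneq b 0.
- case/eqP: (hder_sq_neq0 p); rewrite /hder a0 b0; mx4_simp; ring.
- exists (h3_s3_3 R); split; first by left; apply: List_h3_s3_3.
  apply: presented_h3_s3_3 => //.
  apply: (change 1 (- b^-1)); rewrite ?oppr_eq0 ?invr_eq0 ?expr1n //.
  by rewrite /hder a0; mx4_simp; field.
- exists (s4_7_R2 R); split; first by left; apply: List_s4_7_R2.
  apply: presented_s4_7_R2 => //.
  apply: (change 1 (- a^-1)); rewrite ?oppr_eq0 ?invr_eq0 ?expr1n //.
  by rewrite /hder b0; mx4_simp; field.
- have ba0 : b / a != 0 by rewrite mulf_neq0 ?invr_eq0.
  have sa : - a^-1 != 0 by rewrite oppr_eq0 invr_eq0.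
  case: (ltrgtP (b / a) 0) => [neg|pos|/eqP]; last by rewrite (negbTE ba0).
  + exists (s6_52 (- (b / a))); split.
      by left; apply: List_s6_52; rewrite oppr_gt0.
    apply: presented_s6_52 => //; apply: (change (-1) _ _ sa); first by ring.
    by rewrite /hder; mx4_simp; field.
  + exists (s6_52 (b / a)); split; first by left; apply: List_s6_52.
    apply: presented_s6_52 => //; apply: (change 1 _ _ sa); first by ring.
    by rewrite /hder; mx4_simp; field.
Qed.

Lemma hpres_diagonal_in_list eps a b : hpres eps a b 0 -> in_list.
Proof.
have [-> | eps0] := eqVneq eps 0; first exact: hpres_degenerate_in_list.
exact: hpres_nondegenerate_in_list.
Qed.

(* The complex matrix is i th + D0 with D0^2 = - (eps + d^2); for D0^2 =      *)
(* - r^2 its eigenvectors D0 u +- i r u diagonalize the Hermitian form.       *)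
Lemma hpres_elliptic_in_list th d r : r != 0 -> r + d != 0 ->
  hpres (r ^+ 2 - d ^+ 2) (th + d) (th - d) 1 -> in_list.
Proof.
move=> r0 rd0 p.
(* The eigenvectors have Hermitian norms 2 r (r + d) and 2 r (r - d); the first is normalised to 1,
   and the new eps is the quotient. *)
apply: (@hpres_diagonal_in_list ((r - d) / (r + d)) (th + r) (th - r)).
have two0 : 2%:R != 0 :> R by rewrite pnatr_eq0.
pose h := (2%:R * r)^-1.
move: p; apply: (@change_by_inverse _ _ _ _
  (mx4 [:: [:: 0; d + r; 1; 0]; [:: - (d + r); 0; 0; 1];
           [:: 0; d - r; 1; 0]; [:: r - d; 0; 0; 1]])
  (mx4 [:: [:: 0; - h; 0; h]; [:: h; 0; - h; 0];
           [:: h * (r - d); 0; h * (r + d); 0];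
           [:: 0; h * (r - d); 0; h * (r + d)]])
  1 (2%:R * r * (r + d))^-1); rewrite ?oner_neq0 ?invr_neq0 ?mulf_neq0 //;
rewrite /hform /hder /h; mx4_simp; field; rewrite ?r0 ?rd0 //.
Qed.

(** The Jordan block with d = 0, where the form degenerates. Scaling the second plane by - a^-1
    absorbs the factor that rescaling e puts on c. *)
Lemma hpres_equal_in_list a : hpres 0 a a 1 -> in_list.
Proof.
move=> p; have a0 : a != 0.
  apply: contraNneq (hder_sq_neq0 p) => ->; rewrite /hder.
  by apply/eqP; mx4_simp; ring.
exists (s6_44 R); split; first by left; apply: List_s6_44.
apply: presented_s6_44 => //; move: p.
apply: (@change_by_inverse _ _ _ _
  (mx4 [:: [:: 1; 0; 0; 0]; [:: 0; 1; 0; 0];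
           [:: 0; 0; - a^-1; 0]; [:: 0; 0; 0; - a^-1]])
  (mx4 [:: [:: 1; 0; 0; 0]; [:: 0; 1; 0; 0];
           [:: 0; 0; - a; 0]; [:: 0; 0; 0; - a]])
  (- a^-1) (-1)); rewrite ?oppr_eq0 ?oner_neq0 ?invr_neq0 //;
rewrite /hform /hder /rank2_form; mx4_simp; by field.
Qed.

(* Here w := D0 u is null and killed by D0; u + J w / (2 d) is null too.      *)
Lemma hpres_parabolic_in_list th d : d != 0 ->
  hpres (- d ^+ 2) (th + d) (th - d) 1 -> in_list.
Proof.
move=> d0 p; have th0 : th != 0.
  apply: contraNneq (hder_sq_neq0 p) => ->; rewrite /hder.
  by apply/eqP; mx4_simp; ring.
have two0 : 2%:R != 0 :> R by rewrite pnatr_eq0.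
exists (s6_167 R); split; first by left; apply: List_s6_167.
apply: presented_s6_167 => //; move: p.
pose k := (2%:R * d)^-1; pose h := 2%:R^-1 : R.
apply: (@change_by_form _ _ _ _
  (mx4 [:: [:: h; 0; 0; k]; [:: 0; h; - k; 0];
           [:: 0; - (d / th); - th^-1; 0]; [:: d / th; 0; 0; - th^-1]])
  (- pairing R) (- th^-1) (th / d));
  rewrite ?oppr_eq0 ?oner_neq0 ?invr_neq0 ?mulf_neq0 ?invr_eq0 //;
rewrite /hform /hder /pairing /k /h; mx4_simp; field; rewrite ?d0 ?th0 //.
Qed.

(* The null eigenvectors of D0 are w = D0 u + r u and w' = D0 u - r u; the    *)
(* last two basis vectors are i (r + i d) w' and J of it.                     *)
Lemma hpres_hyperbolic_in_list th d r : 0 < r ->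
  hpres (- (d ^+ 2 + r ^+ 2)) (th + d) (th - d) 1 -> in_list.
Proof.
move=> r_gt0 p.
have two0 : 2%:R != 0 :> R by rewrite pnatr_eq0.
have change r' s D' : s != 0 -> r' != 0 -> r' ^+ 2 = r ^+ 2 ->
    let P := mx4 [:: [:: r'; d; 1; 0]; [:: - d; r'; 0; 1];
                   [:: 0; - (r' ^+ 2 + d ^+ 2); - d; r'];
                   [:: r' ^+ 2 + d ^+ 2; 0; - r'; - d]] in
    D' *m P = s *: (P *m hder (- (d ^+ 2 + r' ^+ 2)) (th + d) (th - d) 1) ->
    presented g (pairing R) D'.
  move=> s0 r0 r2 P DP; move: p; rewrite -r2.
  have n0 : r' ^+ 2 + d ^+ 2 != 0.
    by rewrite paddr_eq0 ?sqr_ge0 // sqrf_eq0 (negbTE r0).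
  apply: (@change_by_form _ _ _ _ P (- pairing R) s
    (2%:R * r' * (r' ^+ 2 + d ^+ 2))^-1) => //.
  - by rewrite invr_neq0 ?mulf_neq0.
  - exact: pairing_sq.
  - by rewrite /P /pairing /hform; mx4_simp; field; rewrite n0 r0.
have r0 : r != 0 by rewrite gt_eqF.
have [th0 | th0] := eqVneq th 0.
  exists (s6_162 R); split; first by left; apply: List_s6_162.
  apply: presented_s6_162 => //; apply: (change r r^-1) => //.
    by rewrite invr_eq0.
  by rewrite /hder th0; mx4_simp; field.
have s0 : - th^-1 != 0 by rewrite oppr_eq0 invr_eq0.
(* Only r^2 is determined by the data, so the sign of the root is chosen to make the parameter of
   s_6.165 positive. *)
have [r' [r'2 r'th]] : exists r', r' ^+ 2 = r ^+ 2 /\ 0 < - (r' / th).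
  case: (ltrgtP th 0) => [neg|pos|/eqP]; last by rewrite (negbTE th0).
    by exists r; split=> //; rewrite -mulrN -invrN divr_gt0 // oppr_gt0.
  by exists (- r); rewrite sqrrN mulNr opprK divr_gt0.
exists (s6_165 (- (r' / th))); split; first by left; apply: List_s6_165.
apply: presented_s6_165 => //; apply: (change r' (- th^-1)) => //.
  by rewrite -sqrf_eq0 r'2 sqrf_eq0.
by rewrite /hder; mx4_simp; field.
Qed.

(** With th the mean of a and b and d half their difference, [del] = eps + d^2 is - D0^2; its sign
    separates the hyperbolic, elliptic and Jordan block cases. *)
Lemma hpres_in_list eps a b c : (c = 0) \/ (c = 1) -> hpres eps a b c -> in_list.
Proof.
case=> ->; first exact: hpres_diagonal_in_list.
have two0 : 2%:R != 0 :> R by rewrite pnatr_eq0.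
pose th := (a + b) / 2%:R; pose d := (a - b) / 2%:R.
have -> : a = th + d by rewrite /th /d; field.
have -> : b = th - d by rewrite /th /d; field.
move: th d => th d {a b c}; move dl: (eps + d ^+ 2) => del.
have -> : eps = del - d ^+ 2 by rewrite -dl; ring.
move: dl => _; case: (ltrgtP del 0) => [neg|pos|->].
- rewrite -[del - _]opprK opprB -[- del]sqr_sqrtr ?oppr_ge0 ?ltW //.
  by apply: hpres_hyperbolic_in_list; rewrite sqrtr_gt0 oppr_gt0.
- have r0 : Num.sqrt del != 0 by rewrite sqrtr_eq0 -ltNge.
  have [rd | rd] := eqVneq (Num.sqrt del + d) 0; last first.
    by rewrite -{1}[del]sqr_sqrtr ?ltW //; apply: hpres_elliptic_in_list.
  have -> : d = - Num.sqrt del by apply/eqP; rewrite -addr_eq0 addrC rd.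
  (* For this root the vector to be normalised is null; with the opposite root r + d becomes -2
     times the square root, which is nonzero. *)
  move=> p; apply: (@hpres_elliptic_in_list th (- Num.sqrt del) (- Num.sqrt del)).
  + by rewrite oppr_eq0.
  + by rewrite -opprD oppr_eq0 -mulr2n mulrn_eq0.
  + by move: p; rewrite !sqrrN sqr_sqrtr ?ltW.
- rewrite sub0r; have [-> | d0] := eqVneq d 0; last exact: hpres_parabolic_in_list.
  by rewrite expr0n /= oppr0 addr0; apply: hpres_equal_in_list.
Qed.

End Classification.

(** * From a complex structure to Hermitian data *)

Lemma dimv_add_line (K : fieldType) (vT : vectType K) (U : {vspace vT}) x :
  x \notin U -> \dim (U + <[x]>) = (\dim U).+1.
Proof.
move=> xU; rewrite dimv_disjoint_sum.
  by rewrite dim_vline -addn1; case: eqVneq xU => // ->; rewrite mem0v.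
apply/eqP; rewrite -subv0; apply/subvP => y; rewrite memv_cap => /andP[yU].
move=> /vlineP[k yE]; move: yU; rewrite yE; have [-> | k0] := eqVneq k 0.
  by rewrite scale0r !mem0v.
by move=> /(memvZ k^-1); rewrite scalerA mulVf // scale1r (negbTE xU).
Qed.

Section LieIdeals.
Variables (R : fieldType) (g : lieAlgType R).
Implicit Types (U V n : {vspace g}).

Lemma lieV_neq0 U V : lieV U V != 0%VS ->
  exists x y, [/\ x \in U, y \in V & [< x, y >] != 0].
Proof.
rewrite /lieV; set s := (X in <<X>>%VS) => s0.
have /hasP[_ /allpairsP[[x y] /= [xU yV ->]] xy0] : has (fun v => v != 0) s.
  apply: contraNT s0 => /hasPn s0; rewrite -subv0; apply/span_subvP => v /s0.
  by rewrite negbK => /eqP ->; apply: mem0v.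
by exists x, y; split=> //; apply: vbasis_mem.
Qed.

Lemma ideal_lieV U V : ideal U -> ideal V -> ideal (lieV U V).
Proof.
move=> /lieV_subP idU /lieV_subP idV; apply/lieV_subP => x y _.
rewrite -adE => yUV; apply: (subvP _ _ (memv_img (ad x) yUV)).
rewrite limg_span; apply/span_subvP =>
  _ /mapP[_ /allpairsP[[u v] /=] [uU vV ->] ->].
rewrite adE; have := lie_jacobi x u v.
rewrite -addrA => /eqP; rewrite addr_eq0 => /eqP ->; rewrite memvN memvD //.
  apply: mem_lieV; first exact: vbasis_mem.
  by rewrite lieC memvN idV ?memvf ?vbasis_mem.
rewrite lieC memvN; apply: mem_lieV; last exact: vbasis_mem.
by rewrite idU ?memvf ?vbasis_mem.
Qed.

End LieIdeals.

Lemma almost_nilpotent_nonnilpotent (R : fieldType) (g : lieAlgType R)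
    (n : {vspace g}) :
  almost_nilpotent n -> ~ nilpotent (fullv : {vspace g}).
Proof.
move=> [_ [_ _ maxn] dimn] nil.
have := maxn fullv (subvf _) nil (subvf _) => nE.
by move: dimn; rewrite -nE; apply/eqP; rewrite neq_ltn ltnSn orbT.
Qed.

Lemma adapted_hermitian_basis (R : rcfType) (g : lieAlgType R)
    (n : {vspace g}) (J : 'End(g)) :
    \dim {:g} = 6%N -> almost_nilpotent n -> strongly_unimodular n ->
    \dim (lcs n 1) = 1%N -> complex_structure J -> ~~ (J @: lcs n 1 <= n)%VS ->
  exists eps a b c, (c = 0 \/ c = 1) /\ hpres g eps a b c.
Proof.
move=> dim6 [_ [idn niln _] dimn] [_ _ tr0] dimn1 [JJ NJ] Jn1.
have {dimn} dimn : \dim n = 5 by apply/eqP; rewrite -eqSS dimn dim6.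
have idnP x y : y \in n -> [< x, y >] \in n.
  by move/lieV_subP: idn => H yn; apply: H; rewrite ?memvf.
have [z [n1E z0]] : exists z, lcs n 1 = <[z]>%VS /\ z != 0.
  exists (vpick (lcs n 1)); have zp : vpick (lcs n 1) != 0.
    by rewrite vpick0 -dimv_eq0 dimn1.
  split=> //; apply/eqP; rewrite eq_sym eqEdim dimn1 dim_vline zp andbT.
  by rewrite -memvE memv_pick.
have n1P x y : x \in n -> y \in n -> [< x, y >] \in <[z]>%VS.
  by rewrite -n1E; apply: mem_lieV.
have zn1 : z \in lcs n 1 by rewrite n1E memv_line.
have n1n : (lcs n 1 <= n)%VS.
  by apply/lieV_subP => x y xn yn; apply: idnP.
have zn : z \in n := subvP n1n _ zn1.
have n2 : lcs n 2 = 0%VS.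
  have n21 : (lcs n 2 <= lcs n 1)%VS := lieV_subr n n1n.
  have := nilpotent_lieV_proper niln; rewrite -dimv_eq0 dimn1 orbF.
  rewrite eqEdim n21 dimn1 /= -ltnNge ltnS leqn0 dimv_eq0.
  by move/eqP.
(* R z is an ideal, so ad x multiplies z by a scalar k, which is its trace on n^1/n^2 = R z. *)
have lie_z x : [< x, z >] = 0.
  have : [< x, z >] \in lcs n 1.
    by move/lieV_subP: (ideal_lieV idn idn); apply; rewrite ?memvf.
  rewrite n1E => /vlineP[k xz].
  have := tr0 x 1%N.
  rewrite (@quot_traceE _ _ _ _ _ 1 (fun=> z) k%:M) ?n2 ?sub0v //.
  - by rewrite mxtrace_scalar mulr1n xz => ->; rewrite scale0r.
  - by rewrite dimv0 addn0.
  - by rewrite limg0 subvv.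
  - move=> v; rewrite big_ord1 memv0 scaler_eq0 (negbTE z0) orbF => /eqP v0.
    by apply/rowP => i; rewrite ord1 v0 mxE.
  - by move=> i; rewrite big_ord1 mxE ord1 eqxx mulr1n adE xz subrr mem0v.
have z_lie x : [< z, x >] = 0 by rewrite lieC lie_z oppr0.
set e := J z.
have en : e \notin n by move: Jn1; rewrite n1E limg_line -memvE.
have full : (n + <[e]>)%VS = fullv.
  by apply/eqP; rewrite eqEdim subvf dim6 dimv_add_line ?dimn.
pose V := (n :&: J @: n)%VS.
have memV x : (x \in V) = (x \in n) && (J x \in n).
  rewrite memv_cap; congr (_ && _); apply/memv_imgP/idP => [[y yn ->]|Jx].
    by rewrite JJ memvN.
  by exists (- J x); rewrite ?memvN // linearN /= JJ opprK.
have Vn x : x \in V -> x \in n by rewrite memV => /andP[].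
have JV x : x \in V -> J x \in V.
  by rewrite !memV => /andP[xn Jxn]; rewrite Jxn JJ memvN.
have zV : z \notin V by rewrite memV zn.
(* Since J z = e, the e-component of J x is the multiple of z to subtract from x. *)
have nV x : x \in n -> exists2 k, x - k *: z \in V & True.
  move=> xn; have : J x \in (n + <[e]>)%VS by rewrite full memvf.
  move=> /memv_addP[y yn [_ /vlineP[k ->] Jx]]; exists k => //.
  rewrite memV memvB ?memvZ //=.
  by rewrite linearB linearZ /= Jx addrK.
have dimV : \dim V = 4%N.
  suff Vz : (V + <[z]>)%VS = n.
    by apply/eqP; rewrite -eqSS -(dimv_add_line zV) Vz dimn.
  apply/eqP; rewrite eqEsubv subv_add -memvE zn andbT; apply/andP; split.
    by apply/subvP.
  apply/subvP => x /nV[k xV _]; rewrite -(subrK (k *: z) x) memv_add //.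
  by rewrite memvZ // memv_line.
have JZ k x : J (k *: x) = k *: J x by rewrite linearZ.
have JD x y : J (x + y) = J x + J y by rewrite linearD.
have J0 : J 0 = 0 by rewrite linear0.
have JN x : J (- x) = - J x by rewrite linearN.
have eJ x : [< e, J x >] = J [< e, x >].
  have := NJ z x; rewrite !z_lie linear0 !subr0.
  by move/eqP; rewrite subr_eq0 => /eqP.
have eV x : x \in V -> [< e, x >] \in V.
  move=> xV; rewrite memV -eJ; apply/andP; split; apply: idnP; apply: Vn => //.
  exact: JV.
pose om x y := coord [tuple z] ord0 [< x, y >].
have omE x y : x \in n -> y \in n -> [< x, y >] = om x y *: z.
  move=> xn yn; have := n1P x y xn yn; rewrite -span_seq1.
  move=> /(@coord_span _ _ _ [tuple z]).
  by rewrite big_ord1.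
have om_inj k : k *: z = 0 -> k = 0.
  by move/eqP; rewrite scaler_eq0 (negbTE z0) orbF => /eqP.
have omDl x y w : om (x + y) w = om x w + om y w by rewrite /om lieDl linearD.
have omDr x y w : om w (x + y) = om w x + om w y by rewrite /om !linearD.
have omZl k x w : om (k *: x) w = k * om x w by rewrite /om lieZl linearZ.
have omZr k x w : om w (k *: x) = k * om w x by rewrite /om !linearZ.
have omC x y : om x y = - om y x by rewrite /om lieC linearN.
have omxx x : om x x = 0 by rewrite /om liexx linear0.
have om0 x : om x 0 = 0 by rewrite /om !linear0.
have omNr x y : om x (- y) = - om x y by rewrite -scaleN1r omZr mulN1r.
have omNl x y : om (- x) y = - om x y by rewrite -scaleN1r omZl mulN1r.
(* On V the Nijenhuis identity has a z-part and an e-part; the latter vanishes because e is outside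
   n. *)
have omJ x y : x \in V -> y \in V -> om (J x) y = - om x (J y).
  move=> xV yV; have := NJ x y.
  rewrite !omE ?Vn ?JV // !JZ -!/e => E.
  apply/eqP; rewrite -addr_eq0; apply: contraNT en => k0.
  have : (om (J x) y + om x (J y)) *: e \in n.
    rewrite (_ : _ *: e = (om (J x) (J y) - om x y) *: z) ?memvZ //.
    apply/eqP; rewrite eq_sym -subr_eq0 -E scalerBl scalerDl opprD addrAC.
    by rewrite !addrA.
  by move=> /(memvZ (om (J x) y + om x (J y))^-1); rewrite scalerA mulVf // scale1r.
have omD x y : x \in V -> y \in V -> om [< e, x >] y = - om x [< e, y >].
  move=> xV yV; have [xn yn] := (Vn x xV, Vn y yV); have := lie_jacobi e x y.
  rewrite (omE x y) // linearZ /= lie_z scaler0 add0r.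
  rewrite [[< y, e >]]lieC linearN /= [[< y, _ >]]lieC.
  rewrite (omE x) ?idnP // (omE [< e, x >]) ?idnP //.
  rewrite -opprD -scalerDl => /eqP; rewrite oppr_eq0 => /eqP/om_inj/eqP.
  by rewrite addrC addr_eq0 => /eqP.
have [u [uV p0]] : exists u, u \in V /\ om u (J u) != 0.
  have : lieV n n != 0%VS by rewrite -dimv_eq0 -[lieV n n]/(lcs n 1) dimn1.
  move=> /lieV_neq0[x0 [y0 [x0n y0n xy0]]].
  have [x [y [xV yV {x0 y0 x0n y0n}xy0]]] :
      exists x y, [/\ x \in V, y \in V & om x y != 0].
    have [k xV _] := nV x0 x0n; have [l yV _] := nV y0 y0n.
    exists (x0 - k *: z), (y0 - l *: z); split=> //.
    apply: contra xy0 => /eqP xy; rewrite -(subrK (k *: z) x0).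
    rewrite -(subrK (l *: z) y0) lieDl lieZl z_lie scaler0 addr0.
    by rewrite lieDr lieZr lie_z scaler0 addr0 omE ?Vn // xy scale0r.
  have [x1 | x1] := eqVneq (om x (J x)) 0; last by exists x.
  have [y1 | y1] := eqVneq (om y (J y)) 0; last first.
    by exists y.
  (* Polarization: x and y being isotropic, the norm of x - J y is 2 om(x, y). *)
  exists (x - J y); split; first by rewrite memvB ?JV.
  rewrite JD JN JJ opprK omDl !omDr !omNl !(omJ y) ?JV //.
  rewrite JJ x1 y1 omNr !opprK addr0 (omC y x) add0r opprK -mulr2n.
  by rewrite mulrn_eq0 /= xy0.
set p := om u (J u) in p0.
have JuV := JV u uV.
have ortho w : w \in V -> exists a b w',
    [/\ w' \in V, om u w' = 0, om u (J w') = 0 & w = a *: u + b *: J u + w'].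
  move=> wV; exists (om u (J w) / p), (om u w / p).
  set a := om u (J w) / p; set b := om u w / p.
  exists (w - (a *: u + b *: J u)); split.
  - by rewrite memvB ?memvD ?memvZ.
  - by rewrite omDr omNr omDr !omZr omxx mulr0 add0r -/p divfK ?subrr.
  - rewrite JD JN JD !JZ JJ omDr omNr omDr !omZr omNr omxx oppr0 mulr0.
    by rewrite addr0 -/p divfK ?subrr.
  - by rewrite addrC subrK.
(* Taking v to be the component of [e, u] orthogonal to u normalises c to 1. If it vanishes, any
   nonzero orthogonal v will do, with c = 0. *)
have [v [a0 [a [c [vV v0 [uv uJv] Du c01]]]]] : exists v a0 a c,
    [/\ v \in V, v != 0, om u v = 0 /\ om u (J v) = 0,
        [< e, u >] = a0 *: u + a *: J u + c *: v & c = 0 \/ c = 1].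
  have [a0 [a [w [wV uw uJw Du]]]] := ortho _ (eV u uV).
  have [w0 | w0] := eqVneq w 0; last first.
    by exists w, a0, a, 1; rewrite scale1r; split=> //; right.
  have /subvPn[t tV tU] : ~~ (V <= <<[:: u; J u]>>)%VS.
    apply/negP => /dimvS; rewrite dimV => /leq_trans/(_ (dim_span _)).
    by [].
  have [b0 [b [v [vV uv uJv tE]]]] := ortho t tV.
  exists v, a0, a, 0; split=> //; last by left.
    apply: contraNneq tU => v0; rewrite tE v0 addr0.
    by rewrite memvD ?memvZ ?memv_span ?inE ?eqxx ?orbT.
  by rewrite Du w0 scale0r.
have JvV := JV v vV.
pose X (i : 'I_4) := nth 0 [:: u; J u; v; J v] i.
have lcX (r : 'rV[R]_4) :
    lincomb X r = r 0 0 *: u + r 0 1 *: J u + r 0 2%:R *: v + r 0 3%:R *: J v.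
  rewrite /lincomb !big_ord_recl big_ord0 /= addr0 !addrA /X.
  by congr (_ *: _ + _ *: _ + _ *: _ + _ *: _); congr (r 0 _); apply: val_inj.
have XV i : X i \in V by case: i => [[|[|[|[|//]]]] ?].
have Xfree r : lincomb X r = 0 -> r = 0.
  rewrite lcX => E.
  have r1 : r 0 1 = 0.
    have := congr1 (om u) E; rewrite !omDr !omZr omxx uv uJv -/p om0.
    rewrite !mulr0 !addr0 add0r => /eqP.
    by rewrite mulf_eq0 (negbTE p0) orbF => /eqP.
  have r0 : r 0 0 = 0.
    have := congr1 (fun x => om u (J x)) E.
    rewrite !JD !JZ !JJ J0 om0 !omDr !omZr !omNr omxx uv uJv -/p.
    rewrite !oppr0 !mulr0 !addr0 => /eqP.
    by rewrite mulf_eq0 (negbTE p0) orbF => /eqP.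
  move: E; rewrite r0 r1 !scale0r !add0r; set k := r 0 2%:R; set l := r 0 3%:R.
  (* Apply the conjugate k - l J to k v + l J v = 0. *)
  move=> E; have : (k ^+ 2 + l ^+ 2) *: v = 0.
    have := congr1 (fun x => k *: x - l *: J x) E.
    rewrite JD !JZ JJ J0 !scaler0 subr0 => <-.
    rewrite !scalerDr !scalerA scalerN opprD opprK scalerDl !expr2.
    by rewrite ?addrA (mulrC l k) addrK.
  move/eqP; rewrite scaler_eq0 (negbTE v0) orbF paddr_eq0 ?sqr_ge0 // !sqrf_eq0.
  move=> /andP[/eqP k0 /eqP l0].
  apply/rowP; case=> [[|[|[|[|//]]]] ?]; rewrite mxE;
    [rewrite -r0|rewrite -r1|rewrite -k0|rewrite -l0];
    by congr (r 0 _); apply: val_inj.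
have Xspan x : x \in V -> exists r, x = lincomb X r.
  pose f := linfun (lincomb X : {linear 'rV[R]_4 -> g}).
  have -> : V = limg f.
    apply/eqP; rewrite eq_sym eqEdim; apply/andP; split.
      apply/subvP => _ /memv_imgP[r _ ->]; rewrite lfunE.
      by apply: memv_suml => i _; rewrite memvZ.
    rewrite limg_dim_eq ?dimV ?dimvf // capfv; apply/eqP.
    rewrite -subv0; apply/subvP => r; rewrite memv_ker lfunE memv0.
    by move=> /eqP/Xfree ->.
  by move=> /memv_imgP[r _ ->]; exists r; rewrite lfunE.
have [r Dv] := Xspan _ (eV v vV).
move: Dv; rewrite lcX.
set p1 := r 0 0; set p2 := r 0 1; set b0 := r 0 2%:R; set b := r 0 3%:R => Dv.
set q := om v (J v).
have omJl x y : x \in V -> y \in V -> om (J x) (J y) = om x y.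
  by move=> xV yV; rewrite omJ ?JV // JJ omNr opprK.
have vJu : om v (J u) = 0 by rewrite -[LHS]opprK -omJ // omC uJv !oppr0.
(* Skewness makes the diagonal entry at u imaginary and ties the lower off-diagonal entry to c. *)
have a00 : a0 = 0.
  have := omD u (J u) uV JuV; rewrite eJ Du !JD !JZ JJ.
  rewrite !omDl !omDr !omZl !omZr omNr !omxx vJu uJv -/p => E.
  by apply/(mulIf p0); lra.
have p20 : p2 = 0.
  have := omD u v uV vV; rewrite Du Dv.
  rewrite !omDl !omDr !omZl !omZr !omxx uv uJv (omJ u) // uJv -/p => E.
  by apply/(mulIf p0); lra.
have p1E : p1 * p = - (c * q).
  have := omD u (J v) uV JvV; rewrite eJ Du Dv !JD !JZ !JJ.
  rewrite !omDl !omDr !omZl !omZr !omNr omJl // uv uJv !omxx -/p -/q => E.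
  by lra.
have eX i : [< e, X i >] = lincomb X (row i (mx4
    [:: [:: a0; a; c; 0]; [:: - a; a0; 0; c];
        [:: p1; p2; b0; b]; [:: - p2; p1; - b; b0]])).
  rewrite lcX !mxE /=; case: i => [[|[|[|[|//]]]] ?]; rewrite /X /= ?eJ.
  - by rewrite Du scale0r addr0.
  - by rewrite Du !JD !JZ JJ scalerN scaleNr scale0r addr0 [X in X + _]addrC.
  - exact: Dv.
  - by rewrite Dv !JD !JZ !JJ !scalerN !scaleNr [X in X + _ - _]addrC
       -[LHS]addrA [X in _ + X]addrC !addrA.
(* As q may be 0, skewness does not control the real part b0; the trace 2 (a0 + b0) on n/n^1
   does. *)
have b00 : b0 = 0.
  have := tr0 e 0%N; rewrite (@quot_traceE _ _ _ _ _ 4 X (mx4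
    [:: [:: a0; a; c; 0]; [:: - a; a0; 0; c];
        [:: p1; p2; b0; b]; [:: - p2; p1; - b; b0]])) //.
  - by rewrite /mxtrace !(mxE, big_ord_recl, big_ord0) /= a00 => E; lra.
  - by rewrite dimn1 dimn.
  - by rewrite n1E limg_line adE lie_z -memvE mem0v.
  - by move=> i; apply: Vn.
  - move=> w; rewrite n1E => wz; apply: Xfree.
    have : lincomb X w \in V by apply: memv_suml => i _; rewrite memvZ.
    have /vlineP[k] := wz; rewrite -/(lincomb X w) => ->.
    have [-> | k0] := eqVneq k 0; first by rewrite scale0r.
    by move/(memvZ k^-1); rewrite scalerA mulVf // scale1r (negbTE zV).
  - move=> i; rewrite adE eX /lincomb.
    by under eq_bigr do rewrite mxE; rewrite subrr mem0v.
have vu : om v u = 0 by rewrite omC uv oppr0.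
have Juv : om (J u) v = 0 by rewrite omJ // uJv oppr0.
have Jvu : om (J v) u = 0 by rewrite omC uJv oppr0.
have JuJv : om (J u) (J v) = 0 by rewrite omJl.
have JvJu : om (J v) (J u) = 0 by rewrite omJl.
have Juu : om (J u) u = - p by rewrite omC.
have Jvv : om (J v) v = - q by rewrite omC.
(* Replacing z by p z gives u norm 1 and v norm q / p. *)
exists (q / p), a, b, c; split=> //.
exists (p *: z), e, X; split=> [k l w E|x|i j|i].
- have wV : lincomb X w \in V by apply: memv_suml => i _; rewrite memvZ.
  have l0 : l = 0.
    apply/eqP; apply: contraNT en => l0.
    have : l *: e \in n.
      rewrite (_ : l *: e = - (k *: (p *: z) + lincomb X w)).
        rewrite memvN memvD ?(Vn _ wV) //; apply: memvZ; exact: memvZ.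
      by apply/eqP; rewrite eq_sym -subr_eq0 -opprD oppr_eq0 addrAC E.
    by move/(memvZ l^-1); rewrite scalerA mulVf // scale1r.
  have k0 : k = 0.
    apply/eqP; apply: contraNT zV => k0.
    have kp : k * p != 0 by rewrite mulf_neq0.
    have : (k * p) *: z \in V.
      move: E; rewrite l0 scale0r addr0 scalerA => /eqP; rewrite addr_eq0.
      by move=> /eqP ->; rewrite memvN.
    by move/(memvZ (k * p)^-1); rewrite scalerA mulVf // scale1r.
  by split=> //; apply: Xfree; move: E; rewrite k0 l0 !scale0r !add0r.
- by rewrite lieZl z_lie scaler0.
- rewrite omE ?Vn // scalerA; congr (_ *: _); rewrite /hform mxE.
  case: i => [[|[|[|[|//]]]] ?]; case: j => [[|[|[|[|//]]]] ?];
    rewrite /X /= ?omxx ?uv ?uJv ?vu ?vJu ?Juv ?Jvu ?JuJv ?JvJu ?Juu ?Jvv -?/p -?/q;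
    by field.
- rewrite eX; congr (lincomb X (row i _)); rewrite /hder.
  apply: mx4_congr; rewrite ?a00 ?p20 ?b00 ?oppr0 //.
    by apply: (mulIf p0); rewrite p1E; field.
  by apply: (mulIf p0); rewrite p1E; field.
Qed.

(** * The explicit complex structures and their nilradicals *)

Section Examples.
Variable R : realFieldType.
Implicit Types (E : lieEqs R) (x y : 'rV[R]_6).

Lemma idx_eq k l : (0 < k <= 6)%N -> (0 < l <= 6)%N -> (idx k == idx l) = (k == l).
Proof.
by case: k l => [|k] [|l] //= k6 l6; rewrite -val_eqE /= !inordK.
Qed.

Lemma fvE E k l : (0 < k <= 6)%N -> (0 < l <= 6)%N ->
  (fv E k : 'rV_6) 0 (idx l) = (l == k)%:R.
Proof. by move=> k6 l6; rewrite mxE eqxx idx_eq. Qed.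

Definition row6 (s : seq R) : 'rV[R]_6 := \row_k s`_k.

Lemma row6_idx s k : (0 < k <= 6)%N -> row6 s 0 (idx k) = s`_k.-1.
Proof. by case: k => // k k6; rewrite mxE /idx inordK. Qed.

Definition J1 x : 'rV[R]_6 :=
  row6 [:: - x 0 (idx 6); - x 0 (idx 3); x 0 (idx 2); - x 0 (idx 5);
           x 0 (idx 4); x 0 (idx 1)].

Definition J2 x : 'rV[R]_6 :=
  row6 [:: - x 0 (idx 6); x 0 (idx 4); - x 0 (idx 5); - x 0 (idx 2);
           x 0 (idx 3); x 0 (idx 1)].

Lemma rV_lin a x y k : (a *: x + y) 0 k = a * x 0 k + y 0 k.
Proof. by rewrite !mxE. Qed.

Lemma J1_linear : linear J1.
Proof.
by move=> a x y; apply: eq_idx; split; rewrite rV_lin !row6_idx //= !rV_lin; ring.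
Qed.

Lemma J2_linear : linear J2.
Proof.
by move=> a x y; apply: eq_idx; split; rewrite rV_lin !row6_idx //= !rV_lin; ring.
Qed.

HB.instance Definition _ := GRing.isLinear.Build R _ _ *:%R J1 J1_linear.
HB.instance Definition _ := GRing.isLinear.Build R _ _ *:%R J2 J2_linear.

Definition J1_of E : 'End(lie_of E) := linfun (J1 : {linear 'rV[R]_6 -> 'rV[R]_6}).
Definition J2_of E : 'End(lie_of E) := linfun (J2 : {linear 'rV[R]_6 -> 'rV[R]_6}).

Definition top_coord E (x : lie_of E) : R^o := (x : 'rV_6) 0 (idx 6).

Lemma top_coord_linear E : linear (@top_coord E).
Proof. by move=> a x y; rewrite /top_coord !mxE. Qed.

HB.instance Definition _ E :=
  GRing.isLinear.Build R _ _ *:%R (@top_coord E) (@top_coord_linear E).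

Definition sqnorm i j x := x 0 (idx i) ^+ 2 + x 0 (idx j) ^+ 2.

(* [ad x] multiplies the squared norm of the plane (i, j) by K x_6^2, so only *)
(* elements with x_6 = 0 can lie in a nilpotent ideal.                        *)
Lemma nilradical_top_coord E (n : {vspace lie_of E}) i j (K : R) :
    (0 < i < 6)%N -> (0 < j < 6)%N -> K != 0 ->
    (forall x y, str_lie E x y 0 (idx 6) = 0) ->
    (forall x y, x 0 (idx 6) = 0 -> y 0 (idx 6) = 0 ->
       str_lie E x y = str_lie E x y 0 (idx 1) *: (fv E 1 : 'rV_6)) ->
    (forall x, str_lie E x (fv E 1) = 0) ->
    (forall x y, y 0 (idx 6) = 0 ->
       sqnorm i j (str_lie E x y) = K * x 0 (idx 6) ^+ 2 * sqnorm i j y) ->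
  nilradical n -> forall x : lie_of E, (x \in n) = ((x : 'rV_6) 0 (idx 6) == 0).
Proof.
move=> i6 j6 K0 E6 Em Ez Eq [idn niln maxn].
pose m := lker (linfun (@top_coord E : {linear lie_of E -> R^o})).
have mP x : (x \in m) = ((x : 'rV_6) 0 (idx 6) == 0) by rewrite memv_ker lfunE.
have idm : ideal m by apply/lieV_subP => x y _ _; rewrite mP [X in X == _]E6.
have nilm : nilpotent m.
  exists 2%N; apply/eqP; rewrite -subv0.
  suff m1 : (lcs m 1 <= <[fv E 1]>)%VS.
    apply: subv_trans (lieV_subr _ m1) _.
    apply/lieV_subP => x _ _ /vlineP[k ->].
    by rewrite lieZr [X in _ *: X]Ez scaler0 mem0v.
  apply/lieV_subP => x y; rewrite !mP => /eqP xm /eqP ym.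
  by rewrite [[< x, y >]](Em x y xm ym) memvZ // memv_line.
(* [m] is a nilpotent ideal, so by maximality n equals [m] once it is contained in it. *)
suff nm : (n <= m)%VS by move=> x; rewrite -(maxn m).
apply/subvP => x xn; rewrite mP; apply: contraT => x6.
have [l lP] := nilpotent_ad idn niln xn.
have q0 : sqnorm i j (fv E i) != 0.
  rewrite /sqnorm fvE ?eqxx; last 2 first.
  - by case/andP: i6 => -> /ltnW.
  - by case/andP: i6 => -> /ltnW.
  by rewrite expr1n paddr_eq0 ?ler01 ?sqr_ge0 // oner_eq0.
have f6 : (fv E i : 'rV_6) 0 (idx 6) = 0.
  rewrite fvE //; last by case/andP: i6 => -> /ltnW.
  by case/andP: i6 => _; case: eqP => // <-; rewrite ltnn.
have it k : let y := iter k (lie (x : lie_of E)) (fv E i) in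
    (y : 'rV_6) 0 (idx 6) = 0 /\ sqnorm i j y != 0.
  elim: k => [|k [y6 qy]] //=; split; first exact: E6.
  by rewrite [sqnorm _ _ _](Eq x _ y6) !mulf_neq0 ?expf_neq0.
have [_] := it l; rewrite lP /sqnorm !mxE expr0n /= addr0 eqxx.
by [].
Qed.

(** f_1 is, up to sign, a bracket of two elements of n, hence lies in n^1, while its image f_6 is
    outside n. *)
Lemma jump_nilradical E (n : {vspace lie_of E}) (J : 'End(lie_of E)) a b :
    (forall x : lie_of E, (x \in n) = ((x : 'rV_6) 0 (idx 6) == 0)) ->
    (0 < a < 6)%N -> (0 < b < 6)%N ->
    [< fv E a, fv E b >] = - fv E 1 -> J (fv E 1) = fv E 6 ->
  ~~ (J @: lcs n 1 <= n)%VS.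
Proof.
move=> nP a6 b6 ab J1E.
have fn k : (0 < k < 6)%N -> fv E k \in n.
  move=> /andP[k0 k6]; rewrite nP fvE ?k0 ?(ltnW k6) //.
  by rewrite gtn_eqF.
apply/negP => /subvP sub; have : J (fv E 1) \in n.
  apply: sub; apply: memv_img; rewrite -[fv E 1]opprK -ab memvN.
  by apply: mem_lieV; apply: fn.
by rewrite J1E nP fvE // eqxx oner_eq0.
Qed.

Lemma J1_fv E : [/\ J1_of E (fv E 1) = fv E 6, J1_of E (fv E 2) = fv E 3
                  & J1_of E (fv E 4) = fv E 5].
Proof.
split; rewrite lfunE; apply: eq_idx; split;
  by rewrite row6_idx //= !fvE //= ?oppr0.
Qed.

Lemma J2_fv E : [/\ J2_of E (fv E 1) = fv E 6, J2_of E (fv E 2) = - fv E 4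
                  & J2_of E (fv E 3) = fv E 5].
Proof.
split; rewrite lfunE; apply: eq_idx; split;
  by rewrite row6_idx //= ?[(- _ : 'rV_6) _ _]mxE !fvE //= ?oppr0.
Qed.

End Examples.

(** J is conjugated by the isomorphism. The assumption on h covers every nilradical so that it
    applies to the image of n. *)
Lemma complex_structure_transport (R : fieldType) (g h : lieAlgType R)
    (f : {linear g -> h}) (n : {vspace g}) :
    bijective f -> (forall x y, f [< x, y >] = [< f x, f y >]) -> nilradical n ->
    (forall m : {vspace h}, nilradical m -> exists J : 'End(h),
       complex_structure J /\ ~~ (J @: lcs m 1 <= m)%VS) ->
  exists J : 'End(g), complex_structure J /\ ~~ (J @: lcs n 1 <= n)%VS.
Proof.
move=> [f' fK f'K] fM niln exJ.
have f'_lin : linear f' by move=> a x y; apply: (can_inj fK); rewrite linearP !f'K.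
pose F := linfun f.
pose F' := linfun (HB.pack f' (GRing.isLinear.Build _ _ _ _ f' f'_lin)
  : {linear h -> g}).
have FE x : F x = f x by rewrite lfunE.
have F'E x : F' x = f' x by rewrite lfunE.
have FK : cancel F F' by move=> x; rewrite F'E FE.
have F'K : cancel F' F by move=> x; rewrite FE F'E.
have FM x y : F [< x, y >] = [< F x, F y >] by rewrite !FE.
have F'M := lie_iso_sym FK F'K FM.
have [J [[JJ NJ] Jn]] := exJ _ (nilradical_img FK F'K FM niln).
have JE x : (F' \o J \o F)%VF x = F' (J (F x)) by rewrite !comp_lfunE.
exists (F' \o J \o F)%VF; split.
  split=> [x|x y]; first by rewrite !JE F'K JJ (linearN F') /= FK.
  rewrite !JE !FM !F'K -[[< F' _, F' _ >]]F'M -!(linearB F') /=.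
  by rewrite -[[< x, y >]]FK FM -(linearB F') /= NJ linear0.
apply: contra Jn => Jn; rewrite (lcs_img FK F'K FM).
apply/subvP => _ /memv_imgP[_ /memv_imgP[x xn ->] ->].
rewrite -[J (F x)]F'K memv_img // -JE; apply: (subvP Jn).
exact: memv_img.
Qed.

Section ListedExamples.
Variable R : realFieldType.
Implicit Types (E : lieEqs R) (x y : 'rV[R]_6).

Lemma J1_complex E :
    (forall x y, str_lie E (J1 x) (J1 y) - J1 (str_lie E (J1 x) y)
       - J1 (str_lie E x (J1 y)) - str_lie E x y = 0) ->
  complex_structure (J1_of E).
Proof.
move=> nij; split=> [x|x y]; rewrite !lfunE; last exact: nij.
apply: eq_idx; split; rewrite row6_idx //= ?row6_idx //=;
  by rewrite ?opprK [RHS]mxE.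
Qed.

Lemma J2_complex E :
    (forall x y, str_lie E (J2 x) (J2 y) - J2 (str_lie E (J2 x) y)
       - J2 (str_lie E x (J2 y)) - str_lie E x y = 0) ->
  complex_structure (J2_of E).
Proof.
move=> nij; split=> [x|x y]; rewrite !lfunE; last exact: nij.
apply: eq_idx; split; rewrite row6_idx //= ?row6_idx //=;
  by rewrite ?opprK [RHS]mxE.
Qed.

Lemma rV_N x k : (- x) 0 k = - x 0 k.
Proof. by rewrite mxE. Qed.

Lemma rV_Z a x k : (a *: x) 0 k = a * x 0 k.
Proof. by rewrite mxE. Qed.

End ListedExamples.

(* [formE] tries [form_D] first, which here unfolds [fw] into a difference.   *)
Definition form_simp (R : fieldType) :=
  (@form_fw R, @form_D R, @form_N R, @form_Z R, @form_0 R).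

Ltac coords :=
  rewrite ?(rV_D, rV_N, rV_Z, rV_0) ?row6_idx //= ?(rV_D, rV_N, rV_Z, rV_0);
  rewrite ?str_lie_idx //= ?form_simp ?row6_idx //= ?fvE //=.

Ltac nijenhuis :=
  move=> x y; apply: eq_idx; split; coords; ring.

Ltac nilradical_by i j K :=
  apply: (@nilradical_top_coord _ _ _ i j K);
  [ by [] | by [] | by rewrite ?oner_neq0
  | intros x y; coords; ring
  | intros x y x6 y6; apply: eq_idx; split; coords; rewrite ?x6 ?y6; ring
  | intros x; apply: eq_idx; split; coords; ring
  | intros x y y6; rewrite /sqnorm; coords; rewrite ?y6; ring ].

Ltac bracket := apply: eq_idx; split; coords; ring.

(** * Verification for each listed algebra *)

Section Listed.
Variable R : rcfType.

(** The chosen coordinates are transformed by f_6 through a similarity: (4, 5) for h_3 + s_3.3,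
    where f_6 commutes with f_2 and f_3; for s_6.165 rotation and dilation by a combine to 1 +
    a^2. *)
Lemma list1_nilradical (E : lieEqs R) (n : {vspace lie_of E}) :
    list1 E -> nilradical n ->
  forall x : lie_of E, (x \in n) = ((x : 'rV_6) 0 (idx 6) == 0).
Proof.
have K0 (a : R) : 1 + a ^+ 2 != 0.
  by rewrite paddr_eq0 ?ler01 ?sqr_ge0 // oner_eq0.
case=> [||| b _ || a _ |].
- nilradical_by 4%N 5%N (1 : R).
- nilradical_by 2%N 3%N (1 : R).
- nilradical_by 2%N 3%N (1 : R).
- nilradical_by 2%N 3%N (1 : R).
- nilradical_by 2%N 3%N (1 : R).
- nilradical_by 2%N 3%N (1 + a ^+ 2).
- nilradical_by 2%N 3%N (1 : R).
Qed.

Lemma list2_nilradical (E : lieEqs R) (n : {vspace lie_of E}) :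
    list2 E -> nilradical n ->
  forall x : lie_of E, (x \in n) = ((x : 'rV_6) 0 (idx 6) == 0).
Proof.
case=> [| a _ _].
- nilradical_by 3%N 5%N (1 : R).
- nilradical_by 2%N 4%N (1 : R).
Qed.

Lemma list1_complex_structure (E : lieEqs R) (n : {vspace lie_of E}) :
    list1 E -> nilradical n ->
  complex_structure (J1_of E) /\ ~~ (J1_of E @: lcs n 1 <= n)%VS.
Proof.
move=> listE niln; split.
  by apply: J1_complex; case: listE => [||| ? _ || ? _ |]; nijenhuis.
have nP := list1_nilradical listE niln; have [J1E _ _] := J1_fv E.
have [b b6 ab] : exists2 b, (0 < b < 6)%N & [< fv E 2, fv E b >] = - fv E 1.
  by case: listE => *; [exists 3%N | exists 3%N | exists 3%N | exists 3%N
                      | exists 4%N | exists 4%N | exists 4%N] => //; bracket.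
exact: jump_nilradical nP _ b6 ab J1E.
Qed.

Lemma list2_complex_structure (E : lieEqs R) (n : {vspace lie_of E}) :
    list2 E -> nilradical n ->
  complex_structure (J2_of E) /\ ~~ (J2_of E @: lcs n 1 <= n)%VS.
Proof.
move=> listE niln; split.
  by apply: J2_complex; case: listE => [|? _ _]; nijenhuis.
have nP := list2_nilradical listE niln; have [J1E _ _] := J2_fv E.
have ab : [< fv E 2, fv E 4 >] = - fv E 1 by case: listE => *; bracket.
exact: jump_nilradical nP _ _ ab J1E.
Qed.

End Listed.

Theorem theorem3p1 (R : realType) :
  (forall (g : lieAlgType R) (n : {vspace g}),
     \dim {:g} = 6%N -> almost_nilpotent n -> strongly_unimodular n ->
     \dim (lcs n 1) = 1%N ->
     (exists J : 'End(g),
        complex_structure J /\ ~~ (J @: lcs n 1 <= n)%VS)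
     <->
     (exists E : lieEqs R,
        (list1 E \/ list2 E) /\ lie_isomorphic g (lie_of E)))
  /\
  (forall E : lieEqs R, list1 E ->
   forall n : {vspace lie_of E}, nilradical n ->
   exists J : 'End(lie_of E),
     [/\ complex_structure J, ~~ (J @: lcs n 1 <= n)%VS
       & [/\ J (fv E 1) = fv E 6, J (fv E 2) = fv E 3
           & J (fv E 4) = fv E 5]])
  /\
  (forall E : lieEqs R, list2 E ->
   forall n : {vspace lie_of E}, nilradical n ->
   exists J : 'End(lie_of E),
     [/\ complex_structure J, ~~ (J @: lcs n 1 <= n)%VS
       & [/\ J (fv E 1) = fv E 6, J (fv E 2) = - fv E 4
           & J (fv E 3) = fv E 5]]).

Proof.
split; [move=> g n dim6 nilp unim dimn1; split | split].
- move=> [J [cJ Jn]].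
  have [eps [a [b [c [c01 p]]]]] :=
    adapted_hermitian_basis dim6 nilp unim dimn1 cJ Jn.
  exact: (hpres_in_list dim6 (almost_nilpotent_nonnilpotent nilp) c01 p).
- move=> [E [listE [f [bij_f fM]]]]; have [_ niln _] := nilp.
  apply: (complex_structure_transport bij_f fM niln) => m nilm.
  case: listE => listE; first by exists (J1_of E); apply: list1_complex_structure.
  by exists (J2_of E); apply: list2_complex_structure.
- move=> E listE n niln; have [cJ Jn] := list1_complex_structure listE niln.
  by exists (J1_of E); split=> //; apply: J1_fv.
- move=> E listE n niln; have [cJ Jn] := list2_complex_structure listE niln.
  by exists (J2_of E); split=> //; apply: J2_fv.
Qed.
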